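(* Let $K$ be a finite field of order $q>2$. Let $\mathcal{P}_0,\mathcal{P}_1,\dots,\mathcal{P}_r$ be a weak nested ear decomposition of a bipartite graph $G$. Let $\epsilon$ denote the number of even ears (ears of even length) and pendant edges of the decomposition. Then $$\operatorname{reg} G = \frac{|V_G|+\epsilon-3}{2}\,(q-2).$$
   Context: Graphs are simple (finite, undirected, no loops, no multiple edges) and have no isolated vertices. $V_G$, $E_G$ denote the vertex and edge sets of $G$. Regularity of a graph: $K$ is a finite field of order $q>2$. $K[E_G]$ is the polynomial ring over $K$ with one variable $t_{ij}$ for each edge $\{i,j\}\in E_G$ (standard grading). The vanishing ideal over $G$, $I_q(G)\subset K[E_G]$, is the ideal generated by the homogeneous polynomials $f\in K[E_G]$ which vanish after substituting each variable $t_{ij}$ by $a_ia_j$, for all choices of $a_i\in K^*=K\setminus\{0\}$, $i\in V_G$. (Equivalently, it is the vanishing ideal of the image of the projective torus under $t_{ij}\mapsto x_ix_j$.) $\operatorname{reg} G$ denotes the Castelnuovo–Mumford regularity of the graded $K[E_G]$-module $K[E_G]/I_q(G)$, i.e. $\max\{j-i:\beta_{ij}\neq 0\}$ with $\beta_{ij}$ its graded Betti numbers. (This quotient is Cohen–Macaulay of dimension one, so $\operatorname{reg} G$ is also the least integer from which its Hilbert function equals its Hilbert polynomial.) Paths: a path $\mathcal{P}\subset G$ is a subgraph with an ordering of its vertices $v_0,v_1,\dots,v_\ell$, $\ell>0$, such that $v_1,\dots,v_\ell$ are distinct, $v_0,\dots,v_{\ell-1}$ are distinct, and its edge set consists of the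 $\ell$ distinct edges $\{v_i,v_{i+1}\}$, $0\le i\le \ell-1$; $v_0=v_\ell$ is allowed (then $\mathcal P$ is a cycle, $\ell\ge 3$). The inner vertices are $v_1,\dots,v_{\ell-1}$; the end-vertices are $v_0$ and $v_\ell$; the length is $\ell(\mathcal{P})=\ell$. Weak nested ear decomposition of $G$: a collection of subgraphs $\mathcal{P}_0,\dots,\mathcal{P}_r$ of $G$, $r>0$, whose edge sets form a partition of $E_G$ (the edge set of $\mathcal P_0$ being empty), such that $\mathcal{P}_0$ is a vertex and, for every $1\le i\le r$, $\mathcal{P}_i$ is a path such that either (1) both end-vertices of $\mathcal{P}_i$ belong to some $\mathcal{P}_j$ with $j<i$, and none of its inner vertices belongs to $\mathcal{P}_0\cup\cdots\cup\mathcal{P}_{i-1}$ (then $\mathcal{P}_i$ is called an ear of the decomposition), or (2) $\ell(\mathcal{P}_i)=1$ and only one of the end-vertices of $\mathcal{P}_i$ belongs to $\mathcal{P}_0\cup\cdots\cup\mathcal{P}_{i-1}$ (then $\mathcal{P}_i$ is called a pendant edge of the decomposition); and such that the following nesting condition holds. If $\mathcal{P}_i$ has both its end-vertices in $\mathcal{P}_j$, $j<i$, then $\mathcal{P}_i$ is said to be nested in $\mathcal{P}_j$, and its nest interval in $\mathcal{P}_j$ is the subpath of $\mathcal{P}_j$ determined by the end-vertices of $\mathcal{P}_i$ (the segment between them in the ordering of $\mathcal{P}_j$) if they are distinct, or that single vertex if they coincide. (If $\mathcal{P}_j$ has $v_0=v_\ell$ and this vertex is one of two distinct end-vertices of $\mathcal{P}_i$,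 a choice of one of the two segments is fixed.) If $\mathcal{P}_i$ is a pendant edge, its nest interval is its end-vertex lying in a previous $\mathcal{P}_j$. Nesting condition: if two paths $\mathcal{P}_i$ and $\mathcal{P}_l$ are nested in $\mathcal{P}_j$, with $j<i,l$, then the corresponding nest intervals in $\mathcal{P}_j$ have disjoint edge sets or one edge set is contained in the other. *)

(* Defs.v *)
From mathcomp Require Import all_boot all_order all_algebra.
From mathcomp Require Import mpoly.

Set Implicit Arguments.
Unset Strict Implicit.
Unset Printing Implicit Defensive.

Import GRing.Theory Num.Theory.
Local Open Scope ring_scope.

(* A chain of finitely generated graded free modules over S = K[X_0..X_(n-1)],
     ... -> F_1 -> F_0 -> S,    F_i = \bigoplus_k S(- shift i k).
   Elements of F_i are row vectors and maps act by right multiplication.  The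
   column [aug] is a lift to S of the augmentation F_0 -> S/I. *)
Record free_chain (K : fieldType) (n : nat) := FreeChain {
  rk : nat -> nat;
  shift : forall i, 'I_(rk i) -> int;
  aug : 'cV[{mpoly K[n]}]_(rk 0);
  diff : forall i, 'M[{mpoly K[n]}]_(rk i.+1, rk i)
}.

Section Resolutions.
Variables (K : fieldType) (n : nat).
Implicit Types (F : free_chain K n) (I : {mpoly K[n]} -> Prop).

(* All maps are homogeneous of degree 0; a zero entry is always allowed, since
   it has empty support. *)
Definition graded_chain F :=
  (forall k m, m \in msupp (aug F k 0) -> (mdeg m)%:Z = shift k) /\
  (forall i a b m, m \in msupp (diff F i a b) ->
     (mdeg m)%:Z + shift b = shift a).

Definition exact_chain F I :=
  [/\ forall f, exists u : 'rV_(rk F 0), I (f - (u *m aug F) 0 0),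
      forall u : 'rV_(rk F 0),
        I ((u *m aug F) 0 0) <-> exists w, u = w *m diff F 0
    & forall i (u : 'rV_(rk F i.+1)),
        u *m diff F i = 0 <-> exists w, u = w *m diff F i.+1].

(* The image of F_(i+1) lies in the homogeneous maximal ideal times F_i. *)
Definition minimal_chain F := forall i a b, (diff F i a b)@_0%MM = 0.

Definition minimal_graded_free_resolution F I :=
  [/\ graded_chain F, exact_chain F I & minimal_chain F].

Definition betti F (i : nat) (j : int) : nat :=
  #|[set a : 'I_(rk F i) | shift a == j]|.

(* [is_regularity I rho]: the regularity of S/I is rho, i.e. the maximum of
   j - i over the nonzero graded Betti numbers exists and equals rho.  The
   Betti numbers do not depend on the minimal resolution. *)
Definition is_regularity I (rho : int) :=
  exists F, [/\ minimal_graded_free_resolution F I,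
    forall i j, betti F i j != 0%N -> j - i%:Z <= rho
  & exists i j, betti F i j != 0%N /\ j - i%:Z = rho].

End Resolutions.

Section Graphs.
Variable V : finType.
Implicit Type e : rel V.

Definition simple_graph e := ssrbool.symmetric e /\ irreflexive e.

Definition no_isolated_vertex e := forall u, exists v, e u v.

Definition bipartite e :=
  exists side : V -> bool, forall u v, e u v -> side u != side v.

Definition edge_set e : {set {set V}} :=
  [set [set p.1; p.2] | p : V * V & e p.1 p.2].

End Graphs.

Definition ideal_generated (R : comNzRingType) (A : R -> Prop) (f : R) :=
  exists s : seq (R * R),
    (forall p, p \in s -> A p.2) /\ f = \sum_(p <- s) p.1 * p.2.

(* The variables of K[E_G] are indexed through the enumeration of the edge
   set; the product over the two ends i, j of an edge is a_i a_j. *)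
Definition vanishes_on_torus (K : finFieldType) (V : finType) (e : rel V)
    (f : {mpoly K[#|edge_set e|]}) :=
  forall a : V -> K, (forall v, a v != 0) ->
    f.@[fun k => \prod_(v in (enum_val k : {set V})) a v] = 0.

Definition vanishing_ideal (K : finFieldType) (V : finType) (e : rel V) :
    {mpoly K[#|edge_set e|]} -> Prop :=
  ideal_generated
    (fun f => (exists d : nat, f \is d.-homog) /\ vanishes_on_torus f).

Section Ears.
Variable V : finType.

(* The nonempty vertex sequence v_0, ..., v_l, stored as (v_0, [v_1; ...; v_l])
   as in path.v. *)
Definition vpath := (V * seq V)%type.

Implicit Types (p Q : vpath) (e : rel V).

Definition verts p : seq V := p.1 :: p.2.
Definition plen p : nat := size p.2.
Definition src p : V := p.1.
Definition tgt p : V := last p.1 p.2.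
Definition inner p : seq V := behead (belast p.1 p.2).
Definition pedges p : seq {set V} :=
  pairmap (fun u v => [set u; v]) p.1 p.2.

(* Distinctness of the edges only excludes the sequences v_0, v_1, v_0. *)
Definition graph_path e p :=
  [&& (0 < plen p)%N, path e p.1 p.2, uniq p.2, uniq (belast p.1 p.2)
    & uniq (pedges p)].

(* [nest_interval Q p N]: N is the edge set of a nest interval in Q of a path p
   with both ends in Q.  If Q is closed and its base vertex is exactly one of
   the ends of p, then that vertex has the two positions 0 and [plen Q], and
   both segments qualify. *)
Definition nest_interval Q p (N : {set {set V}}) :=
  if src p == tgt p then N = set0 else
  exists a b : nat,
    [/\ (a < b <= plen Q)%N,
        [set nth (src Q) (verts Q) a; nth (src Q) (verts Q) b]
          = [set src p; tgt p]
      & N = [set E in drop a (take b (pedges Q))]].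

Section Decomposition.
Variables (r : nat) (P : 'I_r.+1 -> vpath).

Definition earlier (i : 'I_r.+1) : {set V} :=
  [set v | [exists j : 'I_r.+1, (j < i)%N && (v \in verts (P j))]].

Definition ends_in (i j : 'I_r.+1) : bool :=
  [&& (j < i)%N, src (P i) \in verts (P j) & tgt (P i) \in verts (P j)].

Definition is_ear (i : 'I_r.+1) : bool :=
  [exists j, ends_in i j] && all [pred v | v \notin earlier i] (inner (P i)).

Definition is_pendant (i : 'I_r.+1) : bool :=
  (plen (P i) == 1%N) &&
  ((src (P i) \in earlier i) (+) (tgt (P i) \in earlier i)).

(* [N i j] is the edge set of the (chosen) nest interval of P_i in P_j.  Pendant
   edges impose no condition, their nest intervals being single vertices. *)
Definition nesting_condition (N : 'I_r.+1 -> 'I_r.+1 -> {set {set V}}) :=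
  (forall i j, ends_in i j -> nest_interval (P j) (P i) (N i j)) /\
  (forall i l j, ends_in i j -> ends_in l j ->
     [|| [disjoint N i j & N l j], N i j \subset N l j
       | N l j \subset N i j]).

Definition weak_nested_ear_decomposition (e : rel V) :=
  [/\ (0 < r)%N /\ plen (P ord0) = 0%N,
      forall i, i != ord0 -> graph_path e (P i) && (is_ear i || is_pendant i),
      forall i j, i != j -> [disjoint pedges (P i) & pedges (P j)],
      forall E, E \in edge_set e -> exists i, E \in pedges (P i)
    & exists N, nesting_condition N].

Definition num_even_ears_and_pendants : nat :=
  #|[set i | is_ear i && ~~ odd (plen (P i)) || is_pendant i]|.

End Decomposition.
End Ears.

(* Main.v *)
(** Let m = q - 1 and let N be the sum of floor(l/2) over the ears of length l plus the
    number of pendant edges, so that |V| + epsilon = 2N + 1.  On the torus a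
    monomial only depends on the class of its vertex degrees in (Z/m)^V, so that
    S/I is spanned by pairs (degree, class), every variable is a nonzerodivisor, and
    S/(I + (X_0)) is Artinian with top degree M - m + 1, where M is the maximum over
    all classes of the minimal weight of an edge labelling E -> nat in that class.

    M = N(m - 1).  Two labellings in Z/m have the same class iff they differ by a
    combination of the cycles C_i formed, with alternating signs, by an ear
    and its nest interval.  Adding multiples of C_i for the ears in reverse order
    lowers the weight on each ear to (m - 1) floor(l/2).  Conversely the labelling
    equal to m - 1 on every second edge of each ear and on all pendant edges is
    minimal in its class: nested intervals are laminar, which allows the weights
    of the paths to be compared one interval at a time.

    A minimal resolution is built one syzygy module at a time.  The property
    that X_0, ..., X_(n-1) is a regular sequence on the i-th syzygy in degrees above
    rho + i, and that X_0, ..., X_i is one in all degrees, passes to the next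
    syzygy and bounds the degrees of its generators by rho + i + 1.  A socle element
    of degree rho of S/(I + (X_0)) is carried along up to the (n-1)-st syzygy, where
    it becomes a generator of degree rho + n - 1. *)

Require Import Defs.
From mathcomp Require Import all_boot all_order all_algebra.
From mathcomp Require Import mpoly.
From mathcomp Require Import fingroup cyclic finfield ring zify.
From Stdlib Require Import ClassicalEpsilon.

Set Implicit Arguments.
Unset Strict Implicit.
Unset Printing Implicit Defensive.

Import Order.TTheory GRing.Theory Num.Theory.
Local Open Scope ring_scope.

(** * Homogeneous vectors *)

Section Graded.
Variables (K : fieldType) (n : nat).
Local Notation S := {mpoly K[n]}.
Implicit Types (p q : S) (d j : int).

(** Degrees are integers, so that shifts may be subtracted freely; 0 has every degree, and only 0
    has a negative one. *)
Definition ghom d p := forall m, p@_m != 0 -> (mdeg m)%:Z = d.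

Lemma ghom0 d : ghom d 0.
Proof. by move=> m; rewrite mcoeff0 eqxx. Qed.

Lemma ghomD d p q : ghom d p -> ghom d q -> ghom d (p + q).
Proof.
move=> hp hq m; rewrite mcoeffD; case: (eqVneq p@_m 0) => [->|/hp //].
by rewrite add0r => /hq.
Qed.

Lemma ghomN d p : ghom d p -> ghom d (- p).
Proof. by move=> hp m; rewrite mcoeffN oppr_eq0 => /hp. Qed.

Lemma ghomM d d' p q : ghom d p -> ghom d' q -> ghom (d + d') (p * q).
Proof.
move=> hp hq m; rewrite -mcoeff_msupp => /msuppM_le /allpairsP[[m1 m2] /=].
rewrite !mcoeff_msupp => -[/hp <- /hq <- ->].
by rewrite mdegD PoszD.
Qed.

Lemma ghom_sum (I : Type) (r : seq I) (P : pred I) (f : I -> S) d :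
  (forall i, P i -> ghom d (f i)) -> ghom d (\sum_(i <- r | P i) f i).
Proof. by move=> hf; elim/big_ind: _ => //; [exact: ghom0 | exact: ghomD]. Qed.

Lemma ghomX (m : 'X_{1..n}) : ghom (mdeg m)%:Z 'X_[m].
Proof.
by move=> m'; rewrite mcoeffX; case: (m =P m') => [->|] //; rewrite eqxx.
Qed.

Lemma ghomZ d (c : K) p : ghom d p -> ghom d (c *: p).
Proof. by move=> hp m; rewrite mcoeffZ mulf_eq0 => /norP[_ /hp]. Qed.

Lemma ghom_const (c : K) : ghom 0 c%:MP.
Proof.
move=> m; rewrite mcoeffC; case: (eqVneq m 0%MM) => [->|].
  by rewrite mdeg0.
by rewrite mulr0 eqxx.
Qed.

Definition hcomp d p : S :=
  if d is Posz k then pihomog [measure of mdeg] k p else 0.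

Lemma mcoeff_hcomp d p m :
  (hcomp d p)@_m = if (mdeg m)%:Z == d then p@_m else 0.
Proof.
case: d => [k|k] /=; last by rewrite mcoeff0.
rewrite pihomogE (big_morph _ (mcoeffD m) (mcoeff0 _ m)).
rewrite big_mkcond /= -[RHS]mulr1.
have [hm|hm] := boolP (m \in msupp p).
  rewrite (bigD1_seq m) ?msupp_uniq //= big1 ?addr0; last first.
    by move=> i /negPf ne; case: ifP => // _; rewrite mcoeffZ mcoeffX ne mulr0.
  by rewrite eqz_nat; case: ifP; rewrite ?mul0r // mcoeffZ mcoeffX eqxx.
rewrite (memN_msupp_eq0 hm) if_same mul0r big1_seq // => i /andP[_ hi].
case: ifP => // _; rewrite mcoeffZ mcoeffX; case: eqP => [E|]; rewrite ?mulr0 //.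
by rewrite -E hi in hm.
Qed.

Lemma ghom_hcomp d p : ghom d (hcomp d p).
Proof.
by move=> m; rewrite mcoeff_hcomp; case: ((mdeg m)%:Z =P d) => //; rewrite eqxx.
Qed.

Lemma hcomp_id d p : ghom d p -> hcomp d p = p.
Proof.
move=> hp; apply/mpolyP => m; rewrite mcoeff_hcomp; case: eqP => // ne.
by case: (eqVneq p@_m 0) => [-> //|/hp].
Qed.

Lemma hcomp_ne d d' p : ghom d p -> d' != d -> hcomp d' p = 0.
Proof.
move=> hp ne; apply/mpolyP => m; rewrite mcoeff_hcomp mcoeff0; case: eqP => // e.
case: (eqVneq p@_m 0) => [-> //|/hp]; rewrite e => E.
by rewrite E eqxx in ne.
Qed.

Lemma hcompD d p q : hcomp d (p + q) = hcomp d p + hcomp d q.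
Proof.
apply/mpolyP => m; rewrite mcoeffD !mcoeff_hcomp mcoeffD.
by case: ifP => //; rewrite addr0.
Qed.

Lemma hcomp0 d : hcomp d 0 = 0.
Proof. by apply: hcomp_id; exact: ghom0. Qed.

Lemma hcomp_sum (I : Type) (r : seq I) (P : pred I) (f : I -> S) d :
  hcomp d (\sum_(i <- r | P i) f i) = \sum_(i <- r | P i) hcomp d (f i).
Proof. exact: (big_morph _ (hcompD d) (hcomp0 d)). Qed.

Lemma hcompMr j d p q : ghom d q -> hcomp j (p * q) = hcomp (j - d) p * q.
Proof.
move=> hq; rewrite [p in LHS]mpolyE [p in RHS]mpolyE mulr_suml !hcomp_sum mulr_suml.
apply: eq_bigr => m _.
have hX : ghom (mdeg m)%:Z (p@_m *: 'X_[m]) by apply/ghomZ/ghomX.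
have [E|ne] := eqVneq j ((mdeg m)%:Z + d).
  by rewrite E addrK !hcomp_id //; apply: ghomM.
rewrite (hcomp_ne (ghomM hX hq)) // (hcomp_ne hX) ?mul0r //.
by apply: contraNneq ne => <-; rewrite subrK.
Qed.

Lemma hcomp_part p : exists s : seq int,
  [/\ uniq s, p = \sum_(d <- s) hcomp d p & forall d, d \notin s -> hcomp d p = 0].
Proof.
exists (undup [seq (mdeg m)%:Z | m <- msupp p]); split; first exact: undup_uniq.
  apply/mpolyP => m; rewrite (big_morph _ (mcoeffD m) (mcoeff0 _ m)).
  under eq_bigr => i _ do rewrite mcoeff_hcomp.
  have [hm|hm] := boolP (m \in msupp p).
    rewrite (bigD1_seq (mdeg m)%:Z) ?undup_uniq ?mem_undup ?map_f //=.
    rewrite eqxx big1 ?addr0 // => i ne.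
    by rewrite eq_sym (negPf ne).
  by rewrite (memN_msupp_eq0 hm) big1 // => i _; rewrite if_same.
move=> d; rewrite mem_undup => hd; apply/mpolyP => m.
rewrite mcoeff_hcomp mcoeff0; case: eqP => // E.
case: (eqVneq p@_m 0) => [-> //|]; rewrite -mcoeff_msupp => hm.
by rewrite -E map_f in hd.
Qed.

Section Vectors.
Variables (k : nat) (sh : 'I_k -> int).
Implicit Types (u v : 'rV[S]_k).

Definition homv j u := forall a, ghom (j - sh a) (u 0 a).

Lemma homv0 j : homv j 0.
Proof. by move=> a; rewrite mxE; apply: ghom0. Qed.

Lemma homvD j u v : homv j u -> homv j v -> homv j (u + v).
Proof. by move=> hu hv a; rewrite mxE; apply: ghomD. Qed.

Lemma homvN j u : homv j u -> homv j (- u).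
Proof. by move=> hu a; rewrite mxE; apply: ghomN. Qed.

Lemma homvB j u v : homv j u -> homv j v -> homv j (u - v).
Proof. by move=> hu hv; apply/homvD/homvN. Qed.

Lemma homvZ d j p u : ghom d p -> homv j u -> homv (d + j) (p *: u).
Proof. by move=> hp hu a; rewrite mxE -addrA; apply: ghomM. Qed.

Definition hcompv j u : 'rV_k := \row_a hcomp (j - sh a) (u 0 a).

Lemma homv_hcompv j u : homv j (hcompv j u).
Proof. by move=> a; rewrite mxE; apply: ghom_hcomp. Qed.

Lemma hcompv_id j u : homv j u -> hcompv j u = u.
Proof. by move=> hu; apply/rowP => a; rewrite mxE hcomp_id. Qed.

Lemma hcompv_part u : exists s : seq int, u = \sum_(j <- s) hcompv j u.
Proof.
have /fin_all_exists [s hs] := fun a => hcomp_part (u 0 a).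
(* All degrees [d + sh a] with [d] occurring in entry [a]; a degree that comes only from other
   entries contributes 0 to this one. *)
exists (undup (flatten [seq [seq d + sh a | d <- s a] | a <- enum 'I_k])).
set L := undup _.
apply/rowP => a; rewrite summxE.
under eq_bigr => j _ do rewrite mxE.
have [su sE s0] := hs a.
rewrite [LHS]sE [RHS](bigID (fun j => j - sh a \in s a)) /= [X in _ = _ + X]big1; last first.
  by move=> j /s0.
rewrite addr0.
transitivity (\sum_(d <- [seq j - sh a | j <- [seq j <- L | j - sh a \in s a]]) hcomp d (u 0 a));
  last by rewrite big_map big_filter; apply: eq_bigr.
apply: perm_big; apply: uniq_perm => //.
  rewrite map_inj_uniq; first by rewrite filter_uniq // undup_uniq.
  by move=> x y /addIr.
move=> d; apply/idP/mapP => [hd|[j]]; last by rewrite mem_filter => /andP[h _ ->].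
exists (d + sh a); last by rewrite addrK.
rewrite mem_filter addrK hd mem_undup; apply/flattenP.
exists [seq d + sh a | d <- s a]; last exact: (map_f (fun d => d + sh a)).
by apply/mapP; exists a; rewrite ?mem_enum.
Qed.

End Vectors.

Definition hommx k k' (sh : 'I_k -> int) (sh' : 'I_k' -> int) (B : 'M[S]_(k', k)) :=
  forall a b, ghom (sh' a - sh b) (B a b).

Lemma homv_mulmx k k' (sh : 'I_k -> int) (sh' : 'I_k' -> int) (B : 'M[S]_(k', k)) j w :
  hommx sh sh' B -> homv sh' j w -> homv sh j (w *m B).
Proof.
move=> hB hw b; rewrite mxE; apply: ghom_sum => a _.
by have := ghomM (hw a) (hB a b); rewrite addrA subrK.
Qed.

Lemma hcompv_mulmx k k' (sh : 'I_k -> int) (sh' : 'I_k' -> int) (B : 'M[S]_(k', k)) j w :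
  hommx sh sh' B -> hcompv sh j (w *m B) = hcompv sh' j w *m B.
Proof.
move=> hB; apply/rowP => b; rewrite !mxE hcomp_sum; apply: eq_bigr => a _.
rewrite mxE (hcompMr _ _ (hB a b)); congr (hcomp _ _ * _).
by ring.
Qed.

End Graded.

(** * Partial regular sequences on graded modules *)

Section Chase.
Variables (K : fieldType) (n : nat).
Local Notation S := {mpoly K[n]}.

(* Junk value 0 beyond the last variable. *)
Definition xvar (l : nat) : S := if insub l is Some i then 'X_i else 0.

Lemma xvarE (i : 'I_n) : xvar i = 'X_i.
Proof. by rewrite /xvar valK. Qed.

Lemma ghom_xvar l : ghom 1 (xvar l).
Proof.
rewrite /xvar; case: insubP => [i _ _|_]; last exact: ghom0.
by have := @ghomX K n U_(i)%MM; rewrite mdeg1.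
Qed.

Section Module.
Variables (k : nat) (sh : 'I_k -> int).
Implicit Types (u v z : 'rV[S]_k) (Z : 'rV[S]_k -> Prop) (j : int) (l : nat).

Definition submodule Z :=
  [/\ Z 0, forall u v, Z u -> Z v -> Z (u + v) & forall (p : S) u, Z u -> Z (p *: u)].

Lemma submoduleB Z u v : submodule Z -> Z u -> Z v -> Z (u - v).
Proof.
by case=> _ hD hZ hu hv; apply: hD => //; rewrite -scaleN1r; apply: hZ.
Qed.

Lemma homv_xvar j l u : homv sh (j - 1) u -> homv sh j (xvar l *: u).
Proof. by move=> /(homvZ (@ghom_xvar l)); rewrite addrC subrK. Qed.

Definition full : 'rV[S]_k -> Prop := fun=> True.

(* The degree j part of (X_0, ..., X_(l-1)) Z. *)
Fixpoint vmul Z l j u : Prop :=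
  if l is l'.+1 then
    exists z, [/\ homv sh (j - 1) z, Z z & vmul Z l' j (u - xvar l' *: z)]
  else u = 0.

Lemma full_submodule : submodule full. Proof. by []. Qed.

Lemma vmul_sub Z l j u : submodule Z -> vmul Z l j u -> homv sh j u /\ Z u.
Proof.
move=> hZ; elim: l u => [|l IH] u /=.
  by case: hZ => h0 _ _ ->; split=> //; apply: homv0.
move=> [z [hz Zz /IH [h1 h2]]].
rewrite -(subrK (xvar l *: z) u); split.
  by apply: homvD => //; apply: homv_xvar.
by case: hZ => _ hD hS; apply: hD => //; apply: hS.
Qed.

Lemma vmul_full Z l j u : vmul Z l j u -> vmul full l j u.
Proof.
elim: l u => //= l IH u [z [hz Zz hv]].
by exists z; split=> //; apply: IH.
Qed.

Lemma vmul0 Z l j : submodule Z -> vmul Z l j 0.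
Proof.
move=> hZ; elim: l => //= l IH; exists 0; split; first exact: homv0.
  by case: hZ.
by rewrite scaler0 subr0.
Qed.

Lemma vmulD Z l j u v : submodule Z -> vmul Z l j u -> vmul Z l j v -> vmul Z l j (u + v).
Proof.
move=> hZ; elim: l u v => [|l IH] u v /=; first by move=> -> ->; rewrite addr0.
move=> [z [hz Zz hu]] [w [hw Zw hv]]; exists (z + w); split.
- exact: homvD.
- by case: hZ => _ hD _; apply: hD.
by have := IH _ _ hu hv; rewrite scalerDr opprD addrACA.
Qed.

Lemma vmulZ Z l j d (p : S) u : submodule Z -> ghom d p -> vmul Z l j u ->
  vmul Z l (d + j) (p *: u).
Proof.
move=> hZ hp; elim: l u => [|l IH] u /=; first by move=> ->; rewrite scaler0.
move=> [z [hz Zz hu]]; exists (p *: z); split.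
- by rewrite -addrA; apply: homvZ.
- by case: hZ => _ _ h; apply: h.
by have := IH _ hu; rewrite scalerBr !scalerA mulrC.
Qed.

Lemma vmulN Z l j u : submodule Z -> vmul Z l j u -> vmul Z l j (- u).
Proof.
move=> hZ hu; rewrite -scaleN1r -(add0r j); apply: vmulZ => //.
by apply: ghomN; rewrite -mpolyC1; apply: ghom_const.
Qed.

Lemma vmulB Z l j u v : submodule Z -> vmul Z l j u -> vmul Z l j v -> vmul Z l j (u - v).
Proof. by move=> hZ hu hv; apply: vmulD => //; apply: vmulN. Qed.

Lemma vmul_xvar Z l i j u : submodule Z ->
  vmul Z l (j - 1) u -> vmul Z l j (xvar i *: u).
Proof. by move=> hZ /(vmulZ hZ (@ghom_xvar i)); rewrite addrC subrK. Qed.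

Lemma vmulS Z l j u : submodule Z -> vmul Z l j u -> vmul Z l.+1 j u.
Proof.
move=> hZ hu; exists 0; rewrite scaler0 subr0; split=> //; first exact: homv0.
by case: hZ.
Qed.

Lemma vmul_xvarS Z l j u : submodule Z -> homv sh (j - 1) u -> Z u ->
  vmul Z l.+1 j (xvar l *: u).
Proof. by move=> hZ hu Zu; exists u; split=> //; rewrite subrr; apply: vmul0. Qed.

(** The submodule is spanned by monomial vectors, so membership is decided one monomial at a
    time. *)
Lemma vmul_fullP l j u : (l <= n)%N -> vmul full l j u <->
  homv sh j u /\
  forall a m, (u 0 a)@_m != 0 -> exists2 i : 'I_n, (i < l)%N & m i != 0%N.
Proof.
elim: l u => [|l IH] u hl /=.
  split=> [->|[_ h]]; first by split=> [|a m]; [apply: homv0 | rewrite mxE mcoeff0 eqxx].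
  apply/rowP => a; rewrite mxE; apply/mpolyP => m; rewrite mcoeff0.
  by case: (eqVneq (u 0 a)@_m 0) => // /h[].
pose il := Ordinal hl.
have xE : xvar l = 'X_il by rewrite -xvarE.
have IHl := fun u => IH u (ltnW hl).
split.
  move=> [z [hz _ /IHl [h1 h2]]]; split.
    by rewrite -(subrK (xvar l *: z) u); apply: homvD => //; apply: homv_xvar.
  move=> a m hm; case: (eqVneq (m il) 0%N) => [m0|ne]; last by exists il => //=.
  case: (h2 a m) => [|i hi ne]; last by exists i => //; apply: ltnW.
  rewrite !mxE mcoeffB xE [X in _ - X](_ : _ = 0) ?subr0 //.
  rewrite mulrC; apply/eqP; rewrite mcoeff_eq0 (perm_mem (msuppMX _ _)).
  by apply/mapP => -[m' _ E]; move: m0; rewrite E mnmDE mnm1E eqxx.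
move=> [hu h].
(* [z] is the quotient by X_l of the part of [u] whose monomials contain X_l; every other monomial
   must contain an earlier variable. *)
have [z zD] : exists z : 'rV[S]_k, forall a,
    z 0 a = \sum_(m <- msupp (u 0 a) | m il != 0%N) (u 0 a)@_m *: 'X_[m - U_(il)].
  by eexists (\row_a _) => a; rewrite mxE.
have zE a : xvar l * z 0 a = \sum_(m <- msupp (u 0 a) | m il != 0%N) (u 0 a)@_m *: 'X_[m].
  rewrite zD mulr_sumr xE; apply: eq_bigr => m hm.
  by rewrite -scalerAr -mpolyXD addmC submK // lep1mP.
exists z; split=> //.
  move=> a; rewrite zD big_seq_cond; apply: ghom_sum => m /andP[hm m0].
  rewrite mcoeff_msupp in hm; apply: ghomZ.
  rewrite (_ : j - 1 - sh a = (mdeg (m - U_(il)))%:Z); first exact: ghomX.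
  rewrite addrAC -(hu a m hm).
  have := mdegD (m - U_(il)) U_(il); rewrite submK ?lep1mP // mdeg1 => ->.
  by rewrite PoszD addrK.
apply/IHl; have cE a m : ((u - xvar l *: z) 0 a)@_m = if m il == 0%N then (u 0 a)@_m else 0.
  rewrite !mxE mcoeffB zE (big_morph _ (mcoeffD m) (mcoeff0 _ m)) big_mkcond /=.
  have E (i : 'X_{1..n}) : (if i il != 0%N then ((u 0 a)@_i *: 'X_[i] : S)@_m else 0) =
      if (i == m) && (m il != 0%N) then (u 0 a)@_m else 0.
    rewrite mcoeffZ mcoeffX; case: (i =P m) => [->|_] /=; first by rewrite mulr1.
    by rewrite mulr0 if_same.
  rewrite (eq_bigr _ (fun i _ => E i)).
  case: (eqVneq (m il) 0%N) => [m0|ne].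
    by rewrite big1 ?subr0 // => i _; rewrite andbF.
  have [hm|hm] := boolP (m \in msupp (u 0 a)).
    rewrite (bigD1_seq m) ?msupp_uniq //= eqxx /= big1 ?addr0 ?subrr //.
    by move=> i /negPf ->.
  rewrite (memN_msupp_eq0 hm) big1 ?subr0 // => i _.
  by rewrite if_same.
split=> [a m|a m]; rewrite cE; case: (eqVneq (m il) 0%N) => [m0 hm|]; rewrite ?eqxx //.
  exact: hu.
have [i hi ne] := h _ _ hm.
exists i => //; rewrite ltn_neqAle -ltnS hi andbT.
by apply: contraNneq ne => E; rewrite (_ : i = il) ?m0 //; apply: val_inj.
Qed.

(** Multiplication by X_l leaves the exponents of the earlier variables unchanged: the variables
    form a regular sequence on a free module. *)
Lemma xvar_regular l j u : (l < n)%N -> homv sh (j - 1) u ->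
  vmul full l j (xvar l *: u) -> vmul full l (j - 1) u.
Proof.
move=> hl hu /(vmul_fullP _ _ (ltnW hl)) [_ h].
apply/(vmul_fullP _ _ (ltnW hl)); split=> // a m hm.
pose il := Ordinal hl.
have xE : xvar l = 'X_il by rewrite -xvarE.
have E : (xvar l *: u) 0 a = u 0 a * 'X_il by rewrite mxE xE mulrC.
case: (h a (U_(il) + m)%MM) => [|i hi]; first by rewrite E mcoeffMX.
rewrite mnmDE mnm1E addnC; case: (il =P i) => [E'|_]; last by rewrite addn0; exists i.
by rewrite -E' ltnn in hi.
Qed.

(* Multiplication by X_l is injective on F/(Z + (X_0, ..., X_(l-1)) F), from
   degree j - 1 to degree j. *)
Definition xinj Z l j := forall f z, homv sh (j - 1) f -> homv sh j z -> Z z ->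
  vmul full l j (xvar l *: f - z) ->
  exists z', [/\ homv sh (j - 1) z', Z z' & vmul full l (j - 1) (f - z')].

(* Z meets (X_0, ..., X_(l-1)) F only in (X_0, ..., X_(l-1)) Z: this replaces the
   long exact sequence of Koszul homology. *)
Lemma vmul_full_cap Z l j u : submodule Z -> (forall i, (i < l)%N -> xinj Z i j) ->
  homv sh j u -> Z u -> vmul full l j u -> vmul Z l j u.
Proof.
move=> hZ; elim: l u => [|l IH] u hx hu Zu //= [f [hf _ hv]].
have [] := hx l _ f u hf hu Zu.
- by [].
- by rewrite -opprB; apply: vmulN.
move=> z [hz Zz hg]; exists z; split=> //; apply: IH.
- by move=> i hi; apply: hx; apply: ltnW.
- by apply: homvB => //; apply: homv_xvar.
- by apply: submoduleB => //; case: hZ => _ _ h; apply: h.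
(* Replacing [f] by its representative [z] in Z changes X_l f only by an element of (X_0, ...,
   X_(l-1)) F. *)
rewrite (_ : u - xvar l *: z = (u - xvar l *: f) + xvar l *: (f - z)).
  by apply: vmulD => //; apply: vmul_xvar.
by rewrite scalerBr addrA subrK.
Qed.

(** Regularity on F puts [u] into (X_0, ..., X_(l-1)) F, and [vmul_full_cap] brings it back into Z.
    Only degree j - 1 of F/Z matters here, so the degree bound grows by one with each syzygy. *)
Lemma xinj_sub Z l j u : submodule Z -> (l < n)%N ->
  (forall i, (i < l)%N -> xinj Z i (j - 1)) ->
  homv sh (j - 1) u -> Z u ->
  vmul Z l j (xvar l *: u) -> vmul Z l (j - 1) u.
Proof.
move=> hZ hl hx hu Zu hv; apply: vmul_full_cap => //.
by apply: xvar_regular => //; apply: vmul_full hv.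
Qed.

End Module.

Lemma vmul_mulmx k k' (sh : 'I_k -> int) (sh' : 'I_k' -> int) (B : 'M[S]_(k', k)) Z l j u :
  hommx sh sh' B -> (forall w, Z (w *m B)) ->
  vmul sh' (@full k') l j u -> vmul sh Z l j (u *m B).
Proof.
move=> hB ZB; elim: l u => [|l IH] u /=; first by move=> ->; rewrite mul0mx.
move=> [z [hz _ /IH hv]]; exists (z *m B); split=> //; first exact: homv_mulmx hz.
by rewrite scalemxAl -mulmxBl.
Qed.

Lemma vmul_lift k k' (sh : 'I_k -> int) (sh' : 'I_k' -> int) (B : 'M[S]_(k', k)) Z l j u :
  (forall z, homv sh (j - 1) z -> Z z -> exists2 w, homv sh' (j - 1) w & z = w *m B) ->
  vmul sh Z l j u -> exists2 w, vmul sh' (@full k') l j w & u = w *m B.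
Proof.
move=> gB; elim: l u => [|l IH] u /=; first by move=> ->; exists 0; rewrite ?mul0mx.
move=> [z [hz Zz /IH [w hw E]]].
have [w' hw' E'] := gB _ hz Zz.
exists (w + xvar l *: w').
  by exists w'; split=> //; rewrite addrK.
by rewrite mulmxDl -E -scalemxAl -E' subrK.
Qed.

End Chase.

(** * Minimal resolutions and regularity *)

Section Generators.
Variables (K : finFieldType) (n : nat).
Local Notation S := {mpoly K[n]}.
Variables (k : nat) (sh : 'I_k -> int) (Z : 'rV[S]_k -> Prop).
Hypothesis subZ : submodule Z.

Definition generating k' (sh' : 'I_k' -> int) (B : 'M[S]_(k', k)) :=
  [/\ hommx sh sh' B, forall w, Z (w *m B)
    & forall j z, homv sh j z -> Z z -> exists2 w, homv sh' j w & z = w *m B].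

(** Minimality of the generators in the sense of Nakayama: homogeneous relations have no unit
    coefficient. This makes the next differential minimal. *)
Definition irredundant k' (sh' : 'I_k' -> int) (B : 'M[S]_(k', k)) :=
  forall j w, homv sh' j w -> w *m B = 0 -> forall a, (w 0 a)@_0%MM = 0.

(** A relation with a unit coefficient expresses one generator through the others; that generator is
    dropped. [P] carries degree bounds along. *)
Lemma irredundant_generators (P : int -> Prop) k' (sh' : 'I_k' -> int) (B : 'M[S]_(k', k)) :
  generating sh' B -> (forall a, P (sh' a)) ->
  exists k'' (sh'' : 'I_k'' -> int) (B' : 'M[S]_(k'', k)),
    [/\ generating sh'' B', irredundant sh'' B' & forall a, P (sh'' a)].
Proof.
elim: k' sh' B => [|k' IH] sh' B gB hP.
  by exists 0, sh', B; split=> // j w _ _ [].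
have [irr|nirr] := classic (irredundant sh' B); first by exists k'.+1, sh', B.
have [j [w [a0 [hw wB wa]]]] : exists j w a0,
    [/\ homv sh' j w, w *m B = 0 & (w 0 a0)@_0%MM <> 0].
  apply: NNPP => no; apply: nirr => j w hw wB a; apply: NNPP => wa.
  by apply: no; exists j, w, a.
move/eqP in wa; have jE : j = sh' a0.
  by apply/eqP; rewrite -subr_eq0 -(hw _ _ wa) mdeg0.
pose c := (w 0 a0)@_0%MM.
have wE : w 0 a0 = c%:MP.
  apply/mpolyP => m; rewrite mcoeffC; case: eqVneq => [->|ne]; first by rewrite mulr1.
  rewrite mulr0; apply: contraNeq ne => /(hw a0).
  by rewrite jE subrr => /eqP; rewrite eqz_nat mdeg_eq0.
have [hB ZB gen] := gB.
have delE (v : 'rV[S]_k'.+1) : v 0 a0 = 0 -> v *m B = col' a0 v *m row' a0 B.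
  move=> v0; apply/rowP => b; rewrite !mxE (bigD1_ord a0) //= v0 mul0r add0r.
  by apply: eq_bigr => a _; rewrite !mxE.
apply: (IH (sh' \o lift a0) (row' a0 B)); last by move=> a; apply: hP.
split.
- by move=> a b; rewrite mxE; apply: hB.
- move=> v; pose v' : 'rV[S]_k'.+1 := \row_a (if unlift a0 a is Some b then v 0 b else 0).
  rewrite (_ : v = col' a0 v'); last by apply/rowP => b; rewrite !mxE liftK.
  by rewrite -delE ?mxE ?unlift_none.
move=> j' z hz Zz; have [u hu zE] := gen _ _ hz Zz.
(* Subtracting a multiple of the relation [w] clears coordinate [a0] without changing the image. *)
pose v := u - (c^-1 *: u 0 a0) *: w.
have v0 : v 0 a0 = 0.
  rewrite !mxE wE mulrC mul_mpolyC scalerA mulfV // scale1r subrr //.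
exists (col' a0 v); last by rewrite -delE // mulmxBl -scalemxAl wB scaler0 subr0.
move=> a; rewrite mxE /=; suff: homv sh' j' v by apply.
apply: homvB => //; rewrite -(subrK (sh' a0) j'); apply: homvZ.
  by apply: ghomZ; apply: hu.
by rewrite -jE.
Qed.

(* As K is finite, all homogeneous elements of degree at most D may be taken. *)
Lemma finite_generators (D : int) :
  (forall j z, D < j -> homv sh j z -> Z z -> vmul sh Z n j z) ->
  exists k' (sh' : 'I_k' -> int) (B : 'M[S]_(k', k)),
    generating sh' B /\ forall a, sh' a <= D.
Proof.
move=> hD.
(* In a vector of degree at most [D] all monomials have degree below [L], so the finite type [T]
   encodes every such vector. *)
pose L := (\max_a `|D - sh a|%N).+1.
pose T := {ffun 'I_k * 'X_{1..n < L} -> K}.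
pose vec (t : T) : 'rV[S]_k := \row_a \sum_(m : 'X_{1..n < L}) t (a, m) *: 'X_[m].
pose good (t : T) j := [/\ j <= D, homv sh j (vec t) & Z (vec t)].
have /fin_all_exists [f hf] (t : T) : exists f : 'rV[S]_k * int,
   [/\ homv sh f.2 f.1, Z f.1, f.2 <= D & forall j, good t j -> f.1 = vec t].
  have [[j [h1 h2 h3]]|no] := classic (exists j, good t j); first by exists (vec t, j).
  (* A code of no admissible vector contributes the harmless generator 0 in degree [D]. *)
  exists (0, D); split=> //=; [exact: homv0 | by case: subZ |].
  by move=> j gt; case: no; exists j.
pose k' := #|{: T}|.
pose sh' (i : 'I_k') := (f (enum_val i)).2.
pose B : 'M[S]_(k', k) := \matrix_(i, a) (f (enum_val i)).1 0 a.
have hB : hommx sh sh' B.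
  by move=> i a; rewrite mxE; have [] := hf (enum_val i).
have rowB i : row i B = (f (enum_val i)).1 by apply/rowP => a; rewrite !mxE.
have ZB w : Z (w *m B).
  rewrite mulmx_sum_row; case: subZ => Z0 ZD ZZ; elim/big_ind: _ => // i _.
  by apply: ZZ; rewrite rowB; have [] := hf (enum_val i).
exists k', sh', B; split; last by move=> a; have [] := hf (enum_val a).
(* Induction on the excess of the degree over [D]: above [D], the hypothesis [hD] writes [z] through
   elements of Z of degree one less. *)
split=> // j z; have [N hN] : exists N : nat, j <= D + N%:Z.
  by exists `|j - D|%N; rewrite addrC -lerBlDr; lia.
elim: N j hN z => [|N IH] j hN z hz Zz; last first.
  have [le|lt] := lerP j D; first by apply: IH => //; lia.
  have [||w hw E] := @vmul_lift K n k k' sh sh' B Z n j z; last 1 first.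
  - by exists w => //; have [] := vmul_sub (@full_submodule _ _ _) hw.
  - by apply: IH; lia.
  by apply: hD.
rewrite addr0 in hN.
have [->|z0] := eqVneq z 0; first by exists 0; rewrite ?mul0mx //; apply: homv0.
pose t : T := [ffun am : 'I_k * 'X_{1..n < L} => (z 0 am.1)@_(am.2 : 'X_{1..n})].
have zE : vec t = z.
  apply/rowP => a; rewrite mxE [RHS](@mpolywE _ _ L).
    by apply: eq_bigr => m _; rewrite ffunE.
  rewrite msizeE; apply/bigmax_leqP_seq => m; rewrite mcoeff_msupp => /(hz a) hm _.
  rewrite ltnS; apply: leq_trans (leq_bigmax a); move: hm hN; lia.
have [h1 h2 h3 /(_ j)] := hf t; rewrite zE => fE.
have {}fE : (f t).1 = z by apply: fE; split=> //; rewrite zE.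
(* A nonzero vector has only one degree. *)
have jE : j = (f t).2.
  have /existsP [a za] : [exists a, z 0 a != 0].
    apply: contraNT z0 => /existsPn no; apply/eqP/rowP => a; rewrite mxE.
    by apply/eqP; have := no a; rewrite negbK.
  have hm := mlead_supp za; rewrite mcoeff_msupp in hm.
  by apply: (@addIr _ (- sh a)); rewrite -(hz _ _ hm); rewrite fE in h1; rewrite -(h1 _ _ hm).
exists (delta_mx 0 (enum_rank t)); last by rewrite -rowE rowB enum_rankK.
move=> i; rewrite mxE eqxx /=; case: (i =P _) => [->|_]; last exact: ghom0.
by rewrite /sh' enum_rankK -jE subrr -mpolyC1; apply: ghom_const.
Qed.

End Generators.

(** * From one syzygy module to the next *)

Section Resolution.
Variables (K : finFieldType) (n : nat) (rho : nat).
Local Notation S := {mpoly K[n]}.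

Definition graded_sub k (sh : 'I_k -> int) (Z : 'rV[S]_k -> Prop) :=
  forall u j, Z u -> Z (hcompv sh j u).

(* The i-th syzygy module F/Z: no generator in degree above rho + i, X_0, ..., X_i
   is a regular sequence on it, and so is X_0, ..., X_(n-1) in degrees above
   rho + i. *)
Definition syzygy_bound i k (sh : 'I_k -> int) (Z : 'rV[S]_k -> Prop) :=
  [/\ forall a, sh a <= (rho + i)%:Z,
      forall l j, (l < n)%N -> (rho + i).+1%:Z < j \/ (l <= i)%N -> xinj sh Z l j
    & forall j z, homv sh j z -> Z z -> forall a, (z 0 a)@_0%MM = 0].

(* A nonzero element of degree rho + i of F/(Z + (X_0, ..., X_i) F) that is killed
   by all variables; at i = n - 1 it is a generator of top degree. *)
Definition socle_element i k (sh : 'I_k -> int) (Z : 'rV[S]_k -> Prop) g :=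
  [/\ homv sh (rho + i)%:Z g,
      forall z, homv sh (rho + i)%:Z z -> Z z ->
        ~ vmul sh (@full K n k) i.+1 (rho + i)%:Z (g - z)
    & forall l, (i < l < n)%N -> exists z, [/\ homv sh (rho + i).+1%:Z z, Z z
        & vmul sh (@full K n k) i.+1 (rho + i).+1%:Z (xvar K n l *: g - z)]].

Definition syzygy i k (sh : 'I_k -> int) (Z : 'rV[S]_k -> Prop) :=
  [/\ submodule Z, graded_sub sh Z, syzygy_bound i sh Z
    & (i < n)%N -> exists g, socle_element i sh Z g].

Section Step.
Variables (i k : nat) (sh : 'I_k -> int) (Z : 'rV[S]_k -> Prop).
Hypothesis syzZ : syzygy i sh Z.

Let subZ : submodule Z. Proof. by case: syzZ. Qed.

Let cap l j u : (l <= n)%N -> (rho + i).+1%:Z < j \/ (l <= i.+1)%N ->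
  homv sh j u -> Z u -> vmul sh (@full K n k) l j u -> vmul sh Z l j u.
Proof.
move=> hl hj hu Zu; apply: vmul_full_cap => // l' hl'.
have [_ _ [_ hx _] _] := syzZ; apply: hx; first exact: leq_trans hl' hl.
by case: hj => [->|h]; [left | right; rewrite -ltnS; apply: leq_trans h].
Qed.

Lemma syzygy_in_mul_max j z : homv sh j z -> Z z -> vmul sh (@full K n k) n j z.
Proof.
move=> hz Zz; apply/vmul_fullP => //; split=> // a m hm.
have [_ _ [_ _ h0] _] := syzZ.
have m0 : m != 0%MM by apply: contraNneq hm => ->; rewrite (h0 _ _ hz Zz).
move: m0; rewrite -mdeg_eq0 mdegE sum_nat_eq0 => /forallPn [l hl].
by exists l.
Qed.

Lemma next_generators : exists k' (sh' : 'I_k' -> int) (B : 'M[S]_(k', k)),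
  [/\ generating sh Z sh' B, irredundant sh' B & forall a, sh' a <= (rho + i.+1)%:Z].
Proof.
have [j z hj hz Zz|k' [sh' [B [gB hB]]]] := @finite_generators K n k sh Z subZ (rho + i.+1)%:Z.
  apply: cap => //; last exact: syzygy_in_mul_max.
  by left; rewrite -addnS.
exact: (irredundant_generators (P := fun d => d <= (rho + i.+1)%:Z) gB).
Qed.

Variables (k' : nat) (sh' : 'I_k' -> int) (B : 'M[S]_(k', k)).
Hypotheses (genB : generating sh Z sh' B) (irrB : irredundant sh' B).
Hypothesis boundB : forall a, sh' a <= (rho + i.+1)%:Z.
Let Z' (w : 'rV[S]_k') := w *m B = 0.

Let hommxB : hommx sh sh' B. Proof. by case: genB. Qed.
Let ZB w : Z (w *m B). Proof. by case: genB. Qed.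
Let lift j z : homv sh j z -> Z z -> exists2 w, homv sh' j w & z = w *m B.
Proof. by case: genB => _ _; apply. Qed.

Lemma next_exact u : Z u <-> exists w, u = w *m B.
Proof.
split=> [Zu|[w ->]]; last exact: ZB.
have [_ gZ _ _] := syzZ.
have [s us] := hcompv_part sh u.
have /choice [f hf] : forall j, exists w, hcompv sh j u = w *m B.
  by move=> j; have [|w _ E] := lift (@homv_hcompv _ _ _ sh j u); [apply: gZ | exists w].
exists (\sum_(j <- s) f j); rewrite mulmx_suml us.
by under eq_bigr do rewrite hf.
Qed.

Lemma submodule_ker : submodule Z'.
Proof.
split; rewrite /Z'; first by rewrite mul0mx.
  by move=> u v hu hv; rewrite mulmxDl hu hv addr0.
by move=> p u hu; rewrite -scalemxAl hu scaler0.
Qed.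

(** Lifting the coefficients gives a second preimage of [u *m B]; the two preimages differ by an
    element of the kernel. *)
Lemma vmul_cap_lift l j u : vmul sh Z l j (u *m B) ->
  exists2 z, Z' z & vmul sh' (@full K n k') l j (u - z).
Proof.
move=> /(vmul_lift (fun z => @lift (j - 1) z)) [w hw E].
exists (u - w); first by rewrite /Z' mulmxBl E subrr.
by rewrite opprB addrC subrK.
Qed.

(** F'/Z' is isomorphic to Z, so this is [xinj_sub] carried through [B]; irredundancy gives the
    condition on constant terms. *)
Lemma syzygy_bound_next : syzygy_bound i.+1 sh' Z'.
Proof.
split=> //.
move=> l j hl hj f z hf hz Zz hv.
have [_ _ [_ hx _] _] := syzZ.
have h1 : vmul sh Z l j (xvar K n l *: (f *m B)).
  have := vmul_mulmx hommxB ZB hv.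
  by rewrite mulmxBl (Zz : z *m B = 0) subr0 -scalemxAl.
have h2 : vmul sh Z l (j - 1) (f *m B).
  apply: (@xinj_sub K n k sh Z l j) => //; last exact: homv_mulmx hf.
  move=> l' hl'; apply: hx; first exact: ltn_trans hl' hl.
  case: hj => [hj|hj]; last by right; rewrite -ltnS; apply: leq_trans hj.
  by left; move: hj; rewrite addnS; lia.
have [z' Zz' hz'] := vmul_cap_lift h2.
exists z'; split=> //.
have [h3 _] := vmul_sub (@full_submodule _ _ _) hz'.
by rewrite -(subKr f z'); apply: homvB.
Qed.

(* The connecting map: X_(i+1) g = z + v with z in Z and v in (X_0, ..., X_i) F, and
   z is the new socle element. *)
Lemma socle_next g : (i.+1 < n)%N -> socle_element i sh Z g ->
  exists g', socle_element i.+1 sh' Z' g'.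
Proof.
move=> hi [hg gne hk].
have jE : (rho + i).+1%:Z - 1 = (rho + i)%:Z by lia.
have fS := @full_submodule K n.
have [] := hk i.+1; first by rewrite leqnn.
move=> z [hz Zz hv].
have [g' hg' E] := lift hz Zz.
exists g'; split; first by rewrite addnS.
  (* If g' were trivial, z - X_(i+1) z1 would lie in (X_0, ..., X_i) Z. Cancelling X_(i+1) would put
     g - z1 into (X_0, ..., X_i) F, against the choice of [g]. *)
  rewrite addnS => z' hz' Zz' /(vmul_mulmx hommxB ZB).
  rewrite mulmxBl (Zz' : z' *m B = 0) subr0 -E => -[z1 [hz1 Zz1 hz2]].
  rewrite jE in hz1; apply: (gne z1) => //.
  rewrite -jE; apply: xvar_regular => //; first by apply: homvB; rewrite jE.
  rewrite (_ : _ *: _ = (xvar K n i.+1 *: g - z) + (z - xvar K n i.+1 *: z1)).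
    by apply: vmulD => //; apply: (@vmul_full K n k sh Z i.+1 _ _ hz2).
  by rewrite scalerBr addrA subrK.
move=> l /andP[h1 h2].
have [] := hk l; first by rewrite h2 andbT ltnW.
move=> z' [hz' Zz' hv'].
(* This element of Z is also a combination of X_l g - z' and X_(i+1) g - z, hence lies in (X_0, ...,
   X_i) F. *)
have : vmul sh Z i.+1 (rho + i).+2%:Z (xvar K n l *: z - xvar K n i.+1 *: z').
  have jE' : (rho + i).+2%:Z - 1 = (rho + i).+1%:Z by lia.
  apply: cap; [exact: ltnW | by right | | | ].
  - by apply: homvB; apply: homv_xvar; rewrite jE'.
  - by apply: submoduleB => //; case: subZ => _ _; apply.
  rewrite (_ : _ - _ = xvar K n i.+1 *: (xvar K n l *: g - z') -
                       xvar K n l *: (xvar K n i.+1 *: g - z)).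
    by apply: vmulB => //; apply: vmul_xvar; rewrite ?jE'.
  rewrite !scalerBr !scalerA [xvar K n l * _]mulrC opprB.
  by rewrite [RHS]addrC addrA subrK.
move=> hv2; have : vmul sh Z i.+2 (rho + i).+2%:Z ((xvar K n l *: g') *m B).
  rewrite -scalemxAl -E; exists z'; split; [|exact: Zz'|exact: hv2].
  by have -> : (rho + i).+2%:Z - 1 = (rho + i).+1%:Z by lia.
move=> /vmul_cap_lift [z2 Zz2 hz2]; exists z2; rewrite addnS; split=> //.
have [h3 _] := vmul_sub (fS _) hz2.
rewrite -(subKr (xvar K n l *: g') z2); apply: homvB => //.
by apply: homv_xvar; have -> : (rho + i).+2%:Z - 1 = (rho + i).+1%:Z by lia.
Qed.

Lemma syzygy_next : syzygy i.+1 sh' Z'.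
Proof.
split.
- exact: submodule_ker.
- move=> u j; rewrite /Z' -(hcompv_mulmx _ _ hommxB) => ->.
  by apply: hcompv_id; apply: homv0.
- exact: syzygy_bound_next.
move=> hi; have [_ _ _ [|g hg]] := syzZ; first exact: ltnW.
exact: socle_next hi hg.
Qed.

End Step.

(** Otherwise every monomial of [g] has positive degree, so that [g] lies in (X_0, ..., X_(n-1)) F,
    which is excluded for a socle element at i = n - 1. *)
Lemma top_generator i k (sh : 'I_k -> int) Z g : n = i.+1 ->
  syzygy i sh Z -> socle_element i sh Z g -> exists a, sh a = (rho + i)%:Z.
Proof.
move=> nE [[Z0 _ _] _ [hsh _ _] _] [hg gne _].
apply: NNPP => no; apply: (gne 0); [exact: homv0 | by [] | rewrite subr0 -nE].
apply/vmul_fullP => //; split=> // a m hm.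
have m0 : mdeg m != 0%N.
  apply: contra_notN no => /eqP m0; exists a; apply/esym/eqP.
  by rewrite -subr_eq0 -(hg _ _ hm) m0.
by move: m0; rewrite mdegE sum_nat_eq0 => /forallPn [l hl]; exists l.
Qed.

Record stage := Stage { srk : nat; ssh : 'I_srk -> int; sker : 'rV[S]_srk -> Prop }.

Definition stage_syzygy i (X : stage) := syzygy i (ssh (s := X)) (@sker X).

Record stage_step (X : stage) := StageStep {
  nrk : nat; nsh : 'I_nrk -> int; nmx : 'M[S]_(nrk, srk X) }.

Definition step_good i X (Y : stage_step X) :=
  generating (@ssh X) (@sker X) (@nsh X Y) (nmx Y) /\
  irredundant (@nsh X Y) (nmx Y) /\ forall a, nsh (s := Y) a <= (rho + i.+1)%:Z.

Definition default_step X : stage_step X := @StageStep X 0 (fun=> 0) 0.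

(** [epsilon] with a default value lets [stages] recurse without a proof that each stage is a
    syzygy; [choose_stepP] recovers the specification. *)
Definition choose_step i X : stage_step X :=
  epsilon (inhabits (default_step X)) (step_good i (X := X)).

Definition next_stage i X : stage :=
  let Y := choose_step i X in Stage (@nsh X Y) (fun w => w *m nmx Y = 0).

Fixpoint stages (X : stage) i : stage :=
  if i is i'.+1 then next_stage i' (stages X i') else X.

Lemma choose_stepP i X : stage_syzygy i X -> step_good i (choose_step i X).
Proof.
move=> hX; apply: epsilon_spec.
have [k' [sh' [B [h1 h2 h3]]]] := next_generators hX.
by exists (StageStep sh' B).
Qed.

Lemma stages_syzygy X i : stage_syzygy 0 X -> stage_syzygy i (stages X i).
Proof.
move=> h0; elim: i => //= i /[dup] hi /choose_stepP [h1 [h2 h3]].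
exact: (syzygy_next hi h1 h2 h3).
Qed.

End Resolution.

(** * Regularity from a nonzerodivisor and an Artinian quotient *)

Section RegularityCriterion.
Variables (K : finFieldType) (n : nat) (rho : nat).
Local Notation S := {mpoly K[n]}.
Variable I : S -> Prop.
Hypotheses (I0 : I 0) (ID : forall p q, I p -> I q -> I (p + q))
  (IM : forall p q, I q -> I (p * q)) (Ihcomp : forall d p, I p -> I (hcomp d p)).
Hypothesis I_const : forall d p, ghom d p -> I p -> p@_0%MM = 0.
Hypothesis n_gt0 : (0 < n)%N.
Local Notation X0 := (xvar K n 0).
Hypothesis X0_regular : forall p, I (X0 * p) -> I p.

(* The degree d part of the ideal I + (X_0). *)
Definition in_sum_X0 d p := exists z q, [/\ ghom d z, I z, ghom (d - 1) q & p = z + X0 * q].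

Hypothesis artinian : forall d p, rho%:Z < d -> ghom d p -> in_sum_X0 d p.
Hypothesis top_degree : exists2 s, ghom rho%:Z s & ~ in_sum_X0 rho%:Z s.

Let stage0 := @Stage K n 1 (fun=> 0) (fun u => I (u 0 0)).

Let homv0P d (u : 'rV[S]_1) : homv (fun=> 0) d u <-> ghom d (u 0 0).
Proof.
split=> [/(_ 0)|hu a]; first by rewrite subr0.
by rewrite subr0 (ord1 a).
Qed.

(** For l = 0 injectivity is that of X_0 on S/I. For l > 0 only degrees above rho occur, where S/(I
    + (X_0)) is zero; for the same reason all variables kill an element of degree rho. *)
Lemma stage0_syzygy : stage_syzygy rho 0 stage0.
Proof.
have fS := @full_submodule K n 1.
have sub : submodule (fun u : 'rV[S]_1 => I (u 0 0)).
  by split=> [|u v|p u]; rewrite !mxE; [exact: I0 | exact: ID | exact: IM].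
have in_vmul l d (u : 'rV[S]_1) : (0 < l)%N -> in_sum_X0 d (u 0 0) ->
    exists z, [/\ homv (fun=> 0) d z, I (z 0 0) & vmul (fun=> 0) (@full K n 1) l d (u - z)].
  case: l => // l _ [z [q [hz Iz hq E]]]; exists (const_mx z); rewrite mxE.
  split=> //; first by apply/homv0P; rewrite mxE.
  rewrite (_ : u - _ = X0 *: const_mx q); last first.
    by apply/rowP => a; rewrite !mxE (ord1 a) E addrAC subrr add0r.
  elim: l => [|l IH]; last exact: vmulS.
  by apply: vmul_xvarS => //; apply/homv0P; rewrite mxE.
split=> //.
- by move=> u j Iu; rewrite /= mxE subr0; apply: Ihcomp.
- split=> //.
    move=> l j hl hj f z hf hz Iz; case: l hl hj => [|l] hl hj.
      move=> /= /eqP; rewrite subr_eq0 => /eqP E; exists f; split=> //.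
      + by apply: X0_regular; move: Iz; rewrite -E /= mxE.
      + by rewrite subrr.
    move=> _; apply: in_vmul => //; apply: artinian; last exact/homv0P.
    by case: hj => //; rewrite addn0; lia.
  by move=> j z /homv0P hz Iz a; rewrite (ord1 a); apply: I_const hz Iz.
move=> _; have [s hs ns] := top_degree.
exists (const_mx s); split.
- by apply/homv0P; rewrite mxE addn0.
- rewrite addn0 => z /homv0P hz Iz [q [/homv0P hq _ /= /eqP]].
  rewrite subr_eq0 => /eqP /rowP /(_ 0); rewrite !mxE => E.
  by apply: ns; exists (z 0 0), (q 0 0); split=> //; rewrite -E addrCA subrr addr0.
move=> l /andP[_ hl]; rewrite addn0; apply: in_vmul => //.
apply: artinian; first by lia.
rewrite !mxE (_ : rho.+1%:Z = 1 + rho%:Z) //; apply: ghomM => //.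
exact: ghom_xvar.
Qed.

Let X := stages rho stage0.

Let Y i := choose_step rho i (X i).

Let chain : free_chain K n :=
  @FreeChain K n (fun i => srk (X i)) (fun i => @ssh K n (X i)) (const_mx 1)
    (fun i => nmx (Y i)).

Theorem regularity_criterion : is_regularity I rho%:Z.
Proof.
have syzX i : stage_syzygy rho i (X i) := stages_syzygy i stage0_syzygy.
have stepY i : step_good rho i (Y i) := choose_stepP (syzX i).
have shX i (a : 'I_(srk (X i))) : ssh (s := X i) a <= (rho + i)%:Z.
  by have [_ _ []] := syzX i.
have exactY i u : sker u <-> exists w, u = w *m nmx (Y i).
  by have [gY _] := stepY i; apply: (next_exact (syzX i) gY).
exists chain; split.
- split; first split.
  + move=> k m; rewrite mxE => hm.
    rewrite mcoeff_msupp -mpolyC1 in hm.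
    by rewrite (@ghom_const K n 1 m hm).
  + move=> i a b m; rewrite mcoeff_msupp => hm.
    have [[hB _ _] _] := stepY i.
    by rewrite (hB a b m hm) subrK.
  + split.
    * by move=> f; exists (const_mx f); rewrite !mxE big_ord1 !mxE mulr1 subrr.
    * move=> u; rewrite !mxE big_ord1 !mxE mulr1; exact: (exactY 0 u).
    * move=> i u; exact: (exactY i.+1 u).
  + move=> i a b.
    have [[hB ZB _] _] := stepY i; have [_ _ [_ _ hc] _] := syzX i.
    have := hc _ (row a (nmx (Y i))) _ _ b; rewrite mxE; apply.
    * by move=> c; rewrite mxE; apply: hB.
    * by rewrite rowE; apply: ZB.
- move=> i j; rewrite /betti cards_eq0 => /set0Pn [a]; rewrite inE => /eqP <-.
  by have := shX i a; rewrite /=; lia.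
have [_ _ _ hsoc] := syzX n.-1.
have [|g hg] := hsoc; first by rewrite prednK.
have [|a ha] := top_generator _ (syzX n.-1) hg; first by rewrite prednK.
exists n.-1, (rho + n.-1)%:Z; split; last by lia.
rewrite /betti cards_eq0; apply/set0Pn; exists a.
by rewrite inE /= ha.
Qed.

End RegularityCriterion.

(** * Alternating sums of residues *)

Section Residues.
Variable m' : nat.
Local Notation m := m'.+2.
Local Notation R := 'Z_m.
Implicit Types x y z : R.

Lemma residueD x y : ((x + y)%R <= x + y)%N.
Proof. by rewrite /= leq_mod. Qed.

Lemma residue_natr (k : nat) : (k%:R : R) = (k %% m)%N :> nat.
Proof. by rewrite val_Zp_nat. Qed.

Lemma ltn_residue x : (x < m)%N.
Proof. exact: (ltn_ord x). Qed.

Lemma residue_compl x : (((- 1 - x)%R : R) + x = m'.+1)%N.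
Proof.
have hx : (x <= m'.+1)%N by rewrite -ltnS ltn_residue.
have -> : - 1 - x = (m'.+1 - x)%N%:R :> R.
  rewrite natrB // natr_Zp; congr (_ - _).
  by apply/eqP; rewrite eq_sym -subr_eq0 opprK natr1 (pchar_Zp (isT : (1 < m)%N)).
by rewrite residue_natr modn_small ?subnK // ltnS leq_subr.
Qed.

(** Pair x with -1 - x: their residues add up to m - 1. *)
Lemma sum_residues : ((\sum_(x : R) x).*2 = m * m'.+1)%N.
Proof.
rewrite -addnn {1}(reindex_inj (can_inj (subKr (-1 : R)))) /= -big_split /=.
by under eq_bigr do rewrite residue_compl; rewrite sum_nat_const card_ord.
Qed.

Lemma sum_residues_shift (s : nat) x :
  (\sum_(z : R) (x + (-1) ^+ s * z)%R = \sum_(z : R) z)%N.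
Proof.
rewrite [RHS](reindex_inj (h := fun z => x + (-1) ^+ s * z)) //.
move=> z1 z2 /addrI; rewrite -signr_odd; case: (odd s); last by rewrite !mul1r.
by rewrite !mulN1r => /oppr_inj.
Qed.

Lemma sum_alternating (A : pzRingType) (a b : nat) : (a <= b)%N ->
  \sum_(a <= t < b) (-1) ^+ t = (-1) ^+ a *+ odd (b - a) :> A.
Proof.
move=> /subnKC <-; rewrite addKn; elim: (b - a)%N => [|d IH].
  by rewrite addn0 big_geq.
rewrite addnS big_nat_recr ?leq_addr //= IH exprD -(signr_odd _ d).
by case: (odd d); rewrite ?mulr1n ?mulr0n ?mulrN1 ?subrr ?mulr1 ?add0r.
Qed.

(* Averaging over z gives the bound for even l.  For odd l the sum changes by z
   modulo m, so its values over all z exceed the minimum by at least 0, ..., m - 1,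
   and the average exceeds the minimum by at least (m - 1)/2. *)
Lemma alternating_shift_bound (l : nat) (c : nat -> R) :
  exists z, (\sum_(t < l) (c t + (-1) ^+ t * z)%R <= m'.+1 * l./2)%N.
Proof.
pose f z := (\sum_(t < l) (c t + (-1) ^+ t * z)%R)%N.
have sumf : (\sum_(z : R) f z = l * \sum_(z : R) z)%N.
  rewrite exchange_big /=; under eq_bigr do rewrite sum_residues_shift.
  by rewrite sum_nat_const card_ord.
have [z0 _ hz0] := @arg_minnP R (0 : R) xpredT f isT.
exists z0; rewrite -/(f z0).
have hS := sum_residues; move: sumf hS; set G := (\sum_(z : R) z)%N => sumf hS.
have cardR k : (m * k = \sum_(z : R) k)%N by rewrite sum_nat_const card_ord.
case ol: (odd l); last first.
  have le : (m * f z0 <= \sum_(z : R) f z)%N.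
    by rewrite cardR; apply: leq_sum => z _; apply: hz0.
  have lE : l = (l./2 * 2)%N by rewrite muln2 even_halfK // ol.
  move: le; rewrite sumf lE muln2 -muln2 -mulnA [(2 * G)%N]mulnC muln2 hS -lE.
  by rewrite mulnCA leq_pmul2l // mulnC.
have step z : (f z0 + (z - z0)%R <= f z)%N.
  have E (u : R) : (f u)%:R = \sum_(t < l) c t + u :> R.
    have sgn : \sum_(t < l) (-1) ^+ t = 1 :> R.
      by rewrite -(big_mkord xpredT (fun t => (-1) ^+ t : R)) sum_alternating // subn0 ol.
    transitivity (\sum_(t < l) (c t + (-1) ^+ t * u) : R).
      by rewrite /f natr_sum; apply: eq_bigr => t _; apply: natr_Zp.
    by rewrite big_split /= -mulr_suml sgn mul1r.
  have fE : (f z)%:R = (f z0)%:R + (z - z0) :> R by rewrite !E addrA addrAC addrK.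
  rewrite -(subnKC (hz0 z isT)) leq_add2l.
  have : (f z - f z0)%N%:R = z - z0 :> R by rewrite natrB ?hz0 // fE addrC addKr.
  by move=> <-; rewrite residue_natr leq_mod.
have : (m * f z0 + G <= \sum_(z : R) f z)%N.
  have <- : (\sum_(z : R) (z - z0)%R = G)%N.
    by rewrite /G [RHS](reindex_inj (addIr (- z0))).
  by rewrite cardR -big_split /=; apply: leq_sum => z _; apply: step.
have lE : l = (l./2 * 2).+1 by rewrite muln2 -[LHS]odd_double_half ol.
rewrite sumf [X in (_ <= X * _)%N]lE [(_.+1 * G)%N]mulSn addnC leq_add2l -mulnA
  [(2 * G)%N]mulnC muln2 hS.
by rewrite mulnCA leq_pmul2l // mulnC.
Qed.

(** For the half-open intervals [a, b): disjoint in one of the two orders, or nested in one of the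
    two ways. *)
Definition laminar (T : Type) (a b : T -> nat) (i j : T) :=
  [\/ (b i <= a j)%N, (b j <= a i)%N, (a i <= a j)%N /\ (b j <= b i)%N
    | (a j <= a i)%N /\ (b i <= b j)%N].

(* Induction by removing an interval of minimal length: by laminarity the others
   contribute a constant on it, so that dropping it changes nothing if its
   length is even, and at most [z] if it is odd. *)
Lemma laminar_alternating_bound (T : eqType) (L : seq T) (a b : T -> nat)
    (w z : T -> R) (s l : nat) (y : R) :
  (forall i, i \in L -> (a i <= b i <= l)%N) ->
  (forall i, i \in L -> odd (b i - a i) -> w i = - (-1) ^+ (s + a i) * z i) ->
  (forall i j, i \in L -> j \in L -> laminar a b i j) ->
  (((-1) ^+ s *+ odd l) * (y : nat)%:Z <=
   \sum_(0 <= t < l) (-1) ^+ (s + t)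
      * ((y + \sum_(i <- L | (a i <= t < b i)%N) w i)%R : nat)%:Z
   + \sum_(i <- L | odd (b i - a i)) (z i : nat)%:Z :> int).
Proof.
elim: {L}(size L) {-2}L (erefl (size L)) => [|k IH] L szL hab hw hlam.
  rewrite (size0nil szL) big_nil addr0.
  under eq_bigr do rewrite big_nil addr0 exprD mulrAC.
  by rewrite -mulr_sumr sum_alternating // subn0 expr0 mulrnAr mulr1 mulrnAl.
have [i0 i0L imin] : exists2 i0, i0 \in L & forall i, i \in L -> (b i0 - a i0 <= b i - a i)%N.
  have exP : exists d, has (fun i => b i - a i == d)%N L.
    case: L szL {hab hw hlam IH} => // x L _.
    by exists (b x - a x)%N; rewrite /= eqxx.
  have [d /hasP [i iL /eqP <-] hd] := ex_minnP exP.
  by exists i => // j jL; apply: hd; apply/hasP; exists j.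
have pL := perm_to_rem i0L; set L' := rem i0 L in pL.
have subL i : i \in L' -> i \in L by apply: mem_rem.
have := IH L' _ (fun i h => hab i (subL i h)) (fun i h => hw i (subL i h))
  (fun i j h h' => hlam i j (subL i h) (subL j h')).
rewrite size_rem // szL => /(_ erefl) /le_trans; apply.
rewrite [X in _ <= _ + X](perm_big _ pL) big_cons /=.
pose f t := \sum_(i <- L' | (a i <= t < b i)%N) w i.
have fE t : \sum_(i <- L | (a i <= t < b i)%N) w i =
    (if (a i0 <= t < b i0)%N then w i0 else 0) + f t.
  by rewrite (perm_big _ pL) big_cons; case: ifP; rewrite ?add0r.
have fconst t : (a i0 <= t < b i0)%N -> f t = f (a i0).
  move=> ht; rewrite /f big_seq_cond [RHS]big_seq_cond; apply: eq_bigl => i.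
  case: (boolP (i \in L')) => //= /subL iL.
  have := hlam i0 i i0L iL; have := imin i iL; have := hab i iL; move: ht.
  by move=> h1 h2 h3 [h|h|[h h']|[h h']]; apply/idP/idP; lia.
have /andP [hab0 hb0] := hab i0 i0L.
pose g c : int := \sum_(a i0 <= t < b i0) (-1) ^+ (s + t) * ((c : R) : nat)%:Z.
have gE c : g c = (-1) ^+ (s + a i0) *+ odd (b i0 - a i0) * (c : nat)%:Z.
  rewrite /g -mulr_suml; under eq_bigr do rewrite exprD.
  by rewrite -mulr_sumr sum_alternating // mulrnAr exprD.
(* Sums that agree outside the interval of [i0] differ only by their terms inside it. *)
have splitE (h h' : nat -> R) : (forall t, ~~ (a i0 <= t < b i0)%N -> h t = h' t) ->
    \sum_(0 <= t < l) (-1) ^+ (s + t) * (h t : nat)%:Z -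
      \sum_(0 <= t < l) (-1) ^+ (s + t) * (h' t : nat)%:Z =
    \sum_(a i0 <= t < b i0) (-1) ^+ (s + t) * (h t : nat)%:Z -
      \sum_(a i0 <= t < b i0) (-1) ^+ (s + t) * (h' t : nat)%:Z :> int.
  move=> hh; rewrite -!sumrB.
  rewrite (big_cat_nat (leq0n (a i0))) ?(leq_trans hab0) //=.
  rewrite (big_cat_nat hab0 hb0) //= [X in X + _]big_nat [X in _ + (_ + X)]big_nat.
  rewrite big1 ?add0r; last first.
    by move=> t /andP[_ ht]; rewrite hh ?subrr // leqNgt ht.
  rewrite [X in _ + X]big1 ?addr0 // => t /andP[ht _].
  by rewrite hh ?subrr // negb_and ltnNge ht orbT.
have gE' c h : (forall t, (a i0 <= t < b i0)%N -> h t = c) ->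
    \sum_(a i0 <= t < b i0) (-1) ^+ (s + t) * ((h t : R) : nat)%:Z = g c.
  by move=> hc; rewrite /g; apply: eq_big_nat => t ht; rewrite hc.
have := splitE (fun t => y + \sum_(i <- L | (a i <= t < b i)%N) w i) (fun t => y + f t).
rewrite (gE' (y + (w i0 + f (a i0)))); last by move=> t ht; rewrite fE ht fconst.
rewrite (gE' (y + f (a i0))); last by move=> t ht; rewrite fconst.
rewrite !gE => hdiff.
set A := \sum_(0 <= t < l) _ * (y + \sum_(i <- L | _) _)%R%:Z in hdiff *.
set B := \sum_(0 <= t < l) _ in hdiff *.
have {}hdiff : A - B = ((-1) ^+ (s + a i0) *+ odd (b i0 - a i0)) *
    ((y + (w i0 + f (a i0)))%R : nat)%:Z -
    ((-1) ^+ (s + a i0) *+ odd (b i0 - a i0)) * ((y + f (a i0))%R : nat)%:Z.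
  by apply: hdiff => t /negPf ht; rewrite fE ht add0r.
case: ifP hdiff => [od|_]; last first.
  by rewrite mulr0n !mul0r subr0 => /eqP; rewrite subr_eq0 => /eqP ->.
rewrite mulr1n (hw i0 i0L od) => hdiff.
rewrite addrA lerD2r -subr_ge0 addrAC.
rewrite hdiff.
have -> : y + (- (-1) ^+ (s + a i0) * z i0 + f (a i0)) =
    y + f (a i0) - (-1) ^+ (s + a i0) * z i0 by rewrite mulNr; ring.
move: (y + f (a i0)) (z i0) => c z0.
(* Either sign comes down to subadditivity of residues, applied to c + z0 or to (c - z0) + z0. *)
rewrite -[(-1 : int) ^+ _]signr_odd -[(-1 : R) ^+ _]signr_odd.
case: (odd (s + a i0)); rewrite ?expr1 ?expr0.
  by have := residueD c z0; rewrite !(mulN1r, opprK); lia.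
by have := residueD (c - z0) z0; rewrite subrK !mul1r addrAC subr_ge0 -PoszD lez_nat.
Qed.

End Residues.

(** * Weights of edge labellings *)

Lemma set2_inj (T : finType) (x y u w : T) :
  [set x; y] = [set u; w] -> x = u /\ y = w \/ x = w /\ y = u.
Proof.
move=> /setP h; have := h x; have := h y; have := h u; have := h w.
rewrite !inE !eqxx !orbT /= => hw hu /esym hy /esym hx.
case/orP: hx => /eqP E; subst x; [left|right]; split=> //.
  by case/orP: hy hw => /eqP -> // /orP[] /eqP.
by case/orP: hy hu => /eqP -> // /orP[] /eqP.
Qed.

Section Ears.
Variables (V : finType) (e : rel V) (r : nat) (P : 'I_r.+1 -> vpath V).
Hypotheses (e_simple : simple_graph e) (e_noisol : no_isolated_vertex e).
Hypothesis e_bip : bipartite e.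
Hypothesis decP : weak_nested_ear_decomposition P e.
Implicit Types (i j : 'I_r.+1) (t : nat) (v : V).

Local Notation len i := (plen (P i)).
Definition vert i t : V := nth (src (P i)) (verts (P i)) t.
Definition edge i t : {set V} := nth set0 (pedges (P i)) t.

Lemma size_pedges i : size (pedges (P i)) = len i.
Proof. by rewrite /pedges size_pairmap. Qed.

Lemma edgeE i t : (t < len i)%N -> edge i t = [set vert i t; vert i t.+1].
Proof.
by move=> ht; rewrite /edge /pedges (nth_pairmap (src (P i))) //.
Qed.

Lemma edge_mem i t : (t < len i)%N -> edge i t \in pedges (P i).
Proof. by move=> ht; rewrite mem_nth ?size_pedges. Qed.

Lemma vert_mem i t : (t <= len i)%N -> vert i t \in verts (P i).
Proof. by move=> ht; rewrite mem_nth. Qed.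

Lemma vert0 i : vert i 0 = src (P i). Proof. by []. Qed.

Lemma vert_len i : vert i (len i) = tgt (P i).
Proof. by rewrite /vert /tgt (last_nth (src (P i))). Qed.

Lemma len0 : len ord0 = 0%N.
Proof. by case: decP => -[_ ->]. Qed.

Lemma ord0_of_len i t : (t < len i)%N -> i != ord0.
Proof. by apply: contraTneq => ->; rewrite len0. Qed.

Lemma graph_pathP i : i != ord0 -> graph_path e (P i).
Proof. by case: decP => _ h _ _ _ /h /andP[]. Qed.

Lemma ear_or_pendant i : i != ord0 -> is_ear P i || is_pendant P i.
Proof. by case: decP => _ h _ _ _ /h /andP[]. Qed.

Lemma len_gt0 i : i != ord0 -> (0 < len i)%N.
Proof. by move=> /graph_pathP /and5P[]. Qed.

Lemma ear_neq0 i : is_ear P i -> i != ord0.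
Proof. by apply: contraTneq => ->; rewrite negb_and; apply/orP; left; apply/existsPn. Qed.

Lemma pendant_neq0 i : is_pendant P i -> i != ord0.
Proof. by apply: contraTneq => ->; rewrite /is_pendant len0. Qed.

Lemma ear_not_pendant i : is_ear P i -> is_pendant P i = false.
Proof.
case/andP => /existsP[j /and3P[ji hs ht]] _; apply/negP => /andP[_].
have E (v : V) : v \in verts (P j) -> v \in earlier P i.
  by move=> hv; rewrite inE; apply/existsP; exists j; rewrite ji.
by rewrite !E.
Qed.

Lemma edge_adj i t : (t < len i)%N -> e (vert i t) (vert i t.+1).
Proof.
move=> ht; have /and5P[_ hp _ _ _] := graph_pathP (ord0_of_len ht).
exact: (pathP (src (P i)) hp t ht).
Qed.

Lemma edge_in i t : (t < len i)%N -> edge i t \in edge_set e.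
Proof.
move=> ht; rewrite edgeE //; apply/imsetP; exists (vert i t, vert i t.+1) => //.
by rewrite inE /=; apply: edge_adj.
Qed.

Lemma edge_inj i j s t : (s < len i)%N -> (t < len j)%N -> edge i s = edge j t ->
  i = j /\ s = t.
Proof.
move=> hs ht E.
have ij : i = j.
  apply/eqP; case: decP => _ _ hd _ _; apply: contraT => /hd /pred0P /(_ (edge i s)) /=.
  by rewrite {2}E !edge_mem.
split=> //; rewrite -ij in ht E.
have /and5P[_ _ _ _ hu] := graph_pathP (ord0_of_len hs).
by apply/eqP; rewrite -(nth_uniq set0 _ _ hu) ?size_pedges //; apply/eqP.
Qed.

Lemma sum_edges (A : nmodType) (F : {set V} -> A) :
  \sum_(E in edge_set e) F E = \sum_i \sum_(t < len i) F (edge i t).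
Proof.
have pE i : \sum_(t < len i) F (edge i t) = \sum_(E in edge_set e | E \in pedges (P i)) F E.
  rewrite -(big_mkord xpredT (fun t => F (edge i t))) -size_pedges.
  rewrite -(big_nth set0 xpredT F) /=.
  have [->|i0] := eqVneq i ord0.
    have p0 : pedges (P ord0) = [::] by apply: size0nil; rewrite size_pedges len0.
    by rewrite p0 big_nil big_pred0 // => E; rewrite andbF.
  have /and5P[_ _ _ _ hu] := graph_pathP i0.
  rewrite big_uniq //=; apply: eq_bigl => E.
  apply/idP/andP => [hE|[] //]; split=> //.
  have /(nthP set0) [t ht <-] := hE; apply: edge_in.
  by rewrite -size_pedges.
under [RHS]eq_bigr do rewrite pE.
rewrite (exchange_big_dep (mem (edge_set e))) /=; last by move=> i E _ /andP[].
apply: eq_bigr => E hE; case: decP => _ _ hd hc _.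
have [i iE] := hc E hE.
rewrite (bigD1 i) ?hE //= big1 ?addr0 // => j /andP[jE ji].
by have /pred0P /(_ E) /= := hd _ _ ji; rewrite iE jE.
Qed.

Lemma sum_edgesN (F : {set V} -> nat) :
  (\sum_(E in edge_set e) F E = \sum_i \sum_(t < len i) F (edge i t))%N.
Proof. exact: (sum_edges F). Qed.

Lemma edge_cover (E : {set V}) : E \in edge_set e ->
  exists j, exists2 t, (t < len j)%N & E = edge j t.
Proof.
case: decP => _ _ _ hc _ /hc [j /(nthP set0) [t]].
by rewrite size_pedges => ht <-; exists j, t.
Qed.

Lemma mem_edge i t v : (t < len i)%N ->
  (v \in edge i t : nat) = ((v == vert i t) + (v == vert i t.+1))%N.
Proof.
move=> ht; rewrite edgeE // !inE; case: eqP => [->|_] //=.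
have := edge_adj ht; case: eqP => // <-.
by case: e_simple => _ ->.
Qed.

Lemma vert_side (side : V -> bool) i t : (forall u v, e u v -> side u != side v) ->
  (t <= len i)%N -> side (vert i t) = side (src (P i)) (+) odd t.
Proof.
move=> hside; elim: t => [|t IH] ht; first by rewrite addbF.
have := hside _ _ (edge_adj ht); rewrite (IH (ltnW ht)) oddS.
case: (side (src _)); case: (side (vert i t.+1)); case: (odd t) => //.
Qed.

Lemma verts_inner i : i != ord0 ->
  verts (P i) = src (P i) :: rcons (inner (P i)) (tgt (P i)).
Proof.
move=> /len_gt0; rewrite /verts /inner /tgt /src /plen.
by case: (P i) => x [|y s] //= _; rewrite -lastI.
Qed.

Lemma uniq_inner i : i != ord0 -> uniq (inner (P i)).
Proof.
move=> i0; have /and5P[_ _ _ hu _] := graph_pathP i0.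
move: hu (len_gt0 i0); rewrite /inner /plen; case: (P i) => x [|y s] //=.
by case/andP.
Qed.

Lemma size_inner i : i != ord0 -> size (inner (P i)) = (len i).-1.
Proof.
move=> i0; have := congr1 size (verts_inner i0).
by rewrite /= size_rcons /plen => -[->].
Qed.

Lemma vert_inner i t : i != ord0 -> (0 < t < len i)%N -> vert i t \in inner (P i).
Proof.
move=> i0 /andP[]; case: t => // t _ ht; rewrite /vert verts_inner //= nth_rcons.
have hs : (t < size (inner (P i)))%N by rewrite size_inner // -ltnS prednK // len_gt0.
by rewrite hs mem_nth.
Qed.

(** For t = 0 this is the distinctness of v_0, ..., v_(l-1), otherwise that of v_1, ..., v_l; a
    closed path repeats only its end. *)
Lemma vert_inner_inj i s t : (0 < s < len i)%N -> (t <= len i)%N ->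
  (vert i s == vert i t) = (s == t).
Proof.
move=> hs ht; have i0 : i != ord0 by case/andP: hs => _; apply: ord0_of_len.
have /and5P[_ _ u1 u2 _] := graph_pathP i0.
case: t ht => [|t] ht.
  have E k : (k < len i)%N -> vert i k = nth (src (P i)) (belast (P i).1 (P i).2) k.
    by move=> hk; rewrite /vert /verts lastI nth_rcons size_belast hk.
  case/andP: hs => s0 hs; rewrite !E ?(ltn_trans s0) // nth_uniq // size_belast //.
  exact: ltn_trans hs.
case: s hs => // s /andP[_ hs]; rewrite /vert /= nth_uniq //; exact: ltnW.
Qed.

Lemma verts_earlier i j v : (j < i)%N -> v \in verts (P j) -> v \in earlier P i.
Proof. by move=> ji hv; rewrite inE; apply/existsP; exists j; rewrite ji. Qed.

Lemma mem_edge_verts i t v : (t < len i)%N -> v \in edge i t -> v \in verts (P i).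
Proof.
move=> ht; rewrite edgeE // !inE => /orP[] /eqP ->; apply: vert_mem => //; exact: ltnW.
Qed.

Lemma inner_new i : is_ear P i -> {in inner (P i), forall v, v \notin earlier P i}.
Proof. by case/andP => _ /allP h v /h. Qed.

Definition new_verts i : {set V} := [set v in verts (P i) | v \notin earlier P i].

(** Each vertex is counted on the first path through it; such a path exists because no vertex is
    isolated. *)
Lemma card_verts : #|V| = (\sum_i #|new_verts i|)%N.
Proof.
have cov v : exists i, v \in verts (P i).
  have [u vu] := e_noisol v.
  have [|j [t ht E]] := @edge_cover [set v; u].
    by apply/imsetP; exists (v, u); rewrite ?inE.
  by exists j; apply: (mem_edge_verts ht); rewrite -E !inE eqxx.
have /fin_all_exists [f hf] v : exists i, v \in new_verts i.
  have [i0 hi0] := cov v.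
  have [i hi imin] := @arg_minnP _ i0 (fun i => v \in verts (P i)) (fun i => i : nat) hi0.
  exists i; rewrite inE hi inE; apply/existsPn => j; apply/negP => /andP[ji /imin].
  by rewrite leqNgt ji.
have newE i v : (v \in new_verts i) = (f v == i).
  apply/idP/eqP => [hv|<- //]; have hfv := hf v.
  have lem (k l : 'I_r.+1) : v \in new_verts k -> v \in new_verts l -> (k <= l)%N.
    rewrite !inE => /andP[_ hk] /andP[hl _]; rewrite leqNgt.
    by apply: contra hk => lt; apply/existsP; exists l; rewrite lt.
  by apply: ord_inj; apply: anti_leq; rewrite !lem.
rewrite -sum1_card (partition_big f xpredT) //=; apply: eq_bigr => i _.
by rewrite -sum1_card; apply: eq_bigl => v; rewrite newE.
Qed.

Lemma ear_ends_earlier i : is_ear P i ->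
  (src (P i) \in earlier P i) && (tgt (P i) \in earlier P i).
Proof.
case/andP => /existsP[j /and3P[ji hs ht]] _.
by rewrite !(verts_earlier ji).
Qed.

Lemma card_new_ear i : is_ear P i -> #|new_verts i| = (len i).-1.
Proof.
move=> hi; have i0 := ear_neq0 hi.
rewrite -size_inner // -(card_uniqP (uniq_inner i0)); apply: eq_card => v.
have /andP[hs ht] := ear_ends_earlier hi.
rewrite inE verts_inner // in_cons mem_rcons in_cons; apply/andP/idP => [[]|hv].
  by case/or3P => // /eqP ->; rewrite ?hs ?ht.
by rewrite hv !orbT inner_new.
Qed.

Lemma pendant_new i : is_pendant P i ->
  exists2 v, v \in edge i 0 & new_verts i = [set v].
Proof.
move=> /[dup] /pendant_neq0 i0 /andP[/eqP l1]; have l0 := len_gt0 i0.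
have vE : verts (P i) = [:: vert i 0; vert i 1].
  by move: l1; rewrite /plen /vert /verts; case: (P i) => x [|y []].
rewrite -vert0 -vert_len l1 edgeE // => hx.
have ne : vert i 0 != vert i 1.
  by apply: contraTneq hx => ->; rewrite addbb.
have newE v : (v \in new_verts i) = ((v == vert i 0) || (v == vert i 1)) && (v \notin earlier P i).
  by rewrite inE vE !inE.
case: (boolP (vert i 0 \in earlier P i)) hx => h0 /= h1.
  exists (vert i 1); first by rewrite !inE eqxx orbT.
  apply/setP => v; rewrite newE inE; case: (eqVneq v (vert i 1)) => [->|_].
    by rewrite orbT.
  by rewrite orbF; case: eqP => // ->; rewrite h0.
exists (vert i 0); first by rewrite !inE eqxx.
apply/setP => v; rewrite newE inE; case: (eqVneq v (vert i 0)) => [->|_] //=.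
by case: eqP => // ->; rewrite h1.
Qed.

(** * Labellings modulo m, their classes and cycles *)

Section Cycles.
Variable m' : nat.
Local Notation m := m'.+2.
Local Notation R := 'Z_m.
Implicit Types (c d : {set V} -> R).

(** The unsigned incidence map: it sends a labelling to its class in (Z/m)^V. *)
Definition bd c v : R := \sum_(E in edge_set e | v \in E) c E.

Lemma bdE c v : bd c v = \sum_i \sum_(t < len i) c (edge i t) *+ (v \in edge i t).
Proof.
rewrite /bd big_mkcondr /= (sum_edges (fun E => if v \in E then c E else 0)).
by apply: eq_bigr => i _; apply: eq_bigr => t _; case: ifP.
Qed.

Lemma bd_linear c d (x : R) v : bd (fun E => c E + x * d E) v = bd c v + x * bd d v.
Proof. by rewrite /bd big_split /= mulr_sumr. Qed.

Definition alt j a b (E : {set V}) : R :=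
  \sum_(t < len j) if (a <= t < b)%N && (edge j t == E) then (-1) ^+ (t + a) else 0.

Lemma alt_edge i j a b t : (t < len i)%N ->
  alt j a b (edge i t) = if (i == j) && (a <= t < b)%N then (-1) ^+ (t + a) else 0.
Proof.
move=> ht; rewrite /alt; case: (eqVneq i j) => [ij|ne] /=.
  subst j; rewrite (bigD1 (Ordinal ht)) //= eqxx andbT big1 ?addr0 // => s ne.
  case: ifP => // /andP[_ /eqP /(edge_inj (ltn_ord s) ht) [_ E]].
  by case/eqP: ne; apply: val_inj.
rewrite big1 // => s _; case: ifP => // /andP[_ /eqP /(edge_inj (ltn_ord s) ht) [E _]].
by rewrite E eqxx in ne.
Qed.

(** Consecutive edges cancel at the vertices between them, so the sum telescopes to its two ends. *)
Lemma bd_alt j a b v : (a <= b <= len j)%N ->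
  bd (alt j a b) v = (v == vert j a)%:R - (-1) ^+ (a + b) * (v == vert j b)%:R.
Proof.
move=> /andP[ab bl]; rewrite bdE (bigD1 j) //= [X in _ + X]big1 ?addr0; last first.
  move=> i ne; apply: big1 => t _.
  by rewrite alt_edge // (negPf ne) mul0rn.
pose G t : R := - ((-1) ^+ (t + a) * (v == vert j t)%:R).
transitivity (\sum_(a <= t < b) (G t.+1 - G t)).
  rewrite (big_nat_widen a b (len j)) // (big_nat_widenl a 0) // big_mkcond big_mkord.
  apply: eq_bigr => t _; rewrite alt_edge // eqxx /= andbC.
  case: ifP => _; last by rewrite mul0rn.
  by rewrite mem_edge // /G addSn exprS opprK mulrnDr -mulr_natr -[in X in _ + X]mulr_natr; ring.
rewrite telescope_sumr // /G opprK addrC -signr_odd oddD addbb expr0 mul1r.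
by rewrite [(b + a)%N]addnC.
Qed.

Variable side : V -> bool.
Hypothesis side_e : forall u v, e u v -> side u != side v.
(** [par i] is a path in which the ear P_i is nested, and its nest interval occupies the edge
    positions [na i, nb i); an ear with coinciding ends gets the empty interval at 0. *)
Variables (par : 'I_r.+1 -> 'I_r.+1) (na nb : 'I_r.+1 -> nat).
Hypothesis nested : forall i, is_ear P i ->
  [/\ (par i < i)%N, (na i <= nb i <= len (par i))%N
    & if src (P i) == tgt (P i) then na i = 0%N /\ nb i = 0%N
      else [set vert (par i) (na i); vert (par i) (nb i)] = [set src (P i); tgt (P i)]].
Hypothesis lam : forall i l, is_ear P i -> is_ear P l -> par i = par l -> laminar na nb i l.

(** An ear and its nest interval join the same two vertices, so in a bipartite graph their lengths
    have the same parity. *)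
Lemma odd_nest i : is_ear P i -> odd (na i + nb i) = odd (len i).
Proof.
move=> hi; have [_ /andP[ab bl]] := nested hi.
have sl := vert_side side_e (leqnn (len i)); rewrite vert_len in sl.
case: ifP => [/eqP E [-> ->]|/negP ne]; first by move: sl; rewrite E; case: side; case: odd.
have sa := vert_side side_e (leq_trans ab bl); have sb := vert_side side_e bl.
rewrite oddD => /set2_inj[] [E1 E2]; move: sa sb sl; rewrite E1 E2.
  by do 3!case: (side _); do 3!case: odd.
by do 3!case: (side _); do 3!case: odd.
Qed.

(** The sign that cancels the ends: in odd length both ends count with the same sign, in even length
    it depends on which end the interval starts from. *)
Definition eta i := odd (len i) || (vert (par i) (na i) == src (P i)).

(* The cycle closed by P_i and its nest interval. *)
Definition cyc i (E : {set V}) : R :=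
  alt i 0 (len i) E + (-1) ^+ eta i * alt (par i) (na i) (nb i) E.

Lemma cyc_edge i j t : (t < len j)%N -> cyc i (edge j t) =
  (if j == i then (-1) ^+ t else 0) +
  (if (j == par i) && (na i <= t < nb i)%N then (-1) ^+ (eta i + t + na i) else 0).
Proof.
move=> ht; rewrite /cyc !alt_edge // addn0; congr (_ + _).
  by case: eqP => //= <-; rewrite ht.
by case: ifP => _; [rewrite -exprD addnA | rewrite mulr0].
Qed.

Lemma bd_cyc i v : is_ear P i -> bd (cyc i) v = 0.
Proof.
move=> hi; have [_ hab] := nested hi; have on := odd_nest hi.
rewrite bd_linear !bd_alt ?leqnn // vert0 vert_len add0n.
rewrite -[(-1) ^+ len i]signr_odd -[(-1) ^+ (na i + nb i)]signr_odd on /eta.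
case: ifP => [/eqP E [a0 b0]|ne /set2_inj[] [E1 E2]].
- move: on; rewrite a0 b0 /= => /esym ol; rewrite E ol expr0 !mul1r subrr.
  by rewrite subrr mulr0 addr0.
- by rewrite E1 E2 eqxx orbT expr1; ring.
- rewrite E1 E2 [tgt _ == src _]eq_sym ne orbF; case: odd; rewrite ?expr1 ?expr0; ring.
Qed.

Lemma bd_sub c d v : bd c v = bd d v -> bd (fun E => c E - d E) v = 0.
Proof.
move=> h; transitivity (bd c v + -1 * bd d v); last by rewrite h mulN1r subrr.
by rewrite -bd_linear; apply: eq_bigr => E _; rewrite mulN1r.
Qed.

Lemma bd_new_vert i c v : (forall j t, (i < j)%N -> (t < len j)%N -> c (edge j t) = 0) ->
  v \in new_verts i -> bd c v = \sum_(t < len i) c (edge i t) *+ (v \in edge i t).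
Proof.
move=> hc; rewrite inE => /andP[_ hv]; rewrite bdE (bigD1 i) //= [X in _ + X]big1 ?addr0 // => j ji.
apply: big1 => t _; case: (ltngtP i j) => [ij|lt|/ord_inj E].
- by rewrite hc // mul0rn.
- rewrite (negPf (contra (mem_edge_verts (ltn_ord t)) _)) //.
  exact: contra (verts_earlier lt) hv.
- by rewrite E eqxx in ji.
Qed.

(** An inner vertex is new, so the two edges of the ear there are its only edges in the support of
    [c] and their labels cancel. *)
Lemma ear_alternates i c t : is_ear P i -> (forall v, bd c v = 0) ->
  (forall j t, (i < j)%N -> (t < len j)%N -> c (edge j t) = 0) ->
  (t < len i)%N -> c (edge i t) = (-1) ^+ t * c (edge i 0).
Proof.
move=> hi hb hc; elim: t => [|t IH] ht; first by rewrite mul1r.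
have i0 := ear_neq0 hi.
have hv : vert i t.+1 \in inner (P i) by apply: vert_inner.
have hnew : vert i t.+1 \in new_verts i.
  by rewrite inE inner_new // andbT vert_mem // ltnW.
have := hb (vert i t.+1); rewrite (bd_new_vert hc hnew).
have E (s : 'I_(len i)) : c (edge i s) *+ (vert i t.+1 \in edge i s) =
    (if s == Ordinal ht then c (edge i t.+1) else 0) +
    (if s == Ordinal (ltnW ht) then c (edge i t) else 0).
  rewrite mem_edge // !vert_inner_inj //; last exact: ltnW.
  rewrite mulrnDr eqSS -!val_eqE /= ![_ == s :> nat]eq_sym.
  by congr (_ + _); case: eqP => [->|].
rewrite (eq_bigr _ (fun s _ => E s)) big_split /= -!big_mkcond !big_pred1_eq.
rewrite IH ?(ltnW ht) // => /eqP; rewrite addr_eq0 => /eqP ->.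
by rewrite exprS mulN1r mulNr.
Qed.

(** Descend through the paths. On the last ear in the support [c] alternates, and a multiple of its
    cycle, which otherwise meets only an earlier path, removes it. A pendant edge has label 0, being
    alone at its new vertex. *)
Lemma cycle_decomposition k c : (forall v, bd c v = 0) ->
  (forall j t, (k <= j)%N -> (t < len j)%N -> c (edge j t) = 0) ->
  exists z : 'I_r.+1 -> R, forall j t, (t < len j)%N ->
    c (edge j t) = \sum_(i | is_ear P i) z i * cyc i (edge j t).
Proof.
elim: k c => [|k IH] c hb hc.
  exists (fun=> 0) => j t ht; rewrite hc // big1 // => i _; exact: mul0r.
have [le|lt] := leqP r.+1 k.
  by apply: IH => // j t hj; have := leq_trans le hj; rewrite leqNgt ltn_ord.
pose i := Ordinal lt.
have hci j t : (i < j)%N -> (t < len j)%N -> c (edge j t) = 0 by apply: hc.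
case ei: (is_ear P i); last first.
  apply: IH => // j t hj ht; move: hj; rewrite leq_eqVlt => /orP[/eqP kj|]; last first.
    by move=> hj; apply: hc.
  have E : i = j by apply: ord_inj.
  have := ear_or_pendant (ord0_of_len ht); rewrite -E ei /= => pi.
  have l1 : len i = 1%N by case/andP: pi => /eqP.
  have [v ve vn] := pendant_new pi.
  have := hb v; rewrite (bd_new_vert hci) ?vn ?inE // l1 big_ord1 ve.
  by move: ht; rewrite -E l1; case: t.
pose x := c (edge i 0).
have [||z hz] := IH (fun E => c E + (- x) * cyc i E).
- by move=> v; rewrite bd_linear hb bd_cyc // mulr0 addr0.
- move=> j t; rewrite leq_eqVlt => /orP[/eqP kj|hj] ht.
    have E : j = i by apply: ord_inj; rewrite -kj.
    subst j; rewrite cyc_edge // eqxx; have [pi _ _] := nested ei.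
    rewrite -[i == _]val_eqE (gtn_eqF pi) /= addr0 (ear_alternates ei hb hci ht).
    by rewrite -/x mulNr mulrC subrr.
  rewrite hc // cyc_edge // -!val_eqE /= (gtn_eqF hj).
  have [pi _ _] := nested ei.
  by rewrite (gtn_eqF (ltn_trans pi hj)) /= !add0r mulr0.
exists (fun l => z l + (if l == i then x else 0)) => j t ht.
under eq_bigr do rewrite mulrDl.
rewrite big_split /= -hz // [X in _ = _ + X](bigD1 i) //= eqxx big1; last first.
  by move=> l /andP[_ /negPf ->]; rewrite mul0r.
by rewrite mulNr addr0 subrK.
Qed.

Definition cap i : nat := if is_ear P i then (len i)./2 else is_pendant P i.

Definition ear_sum : nat := (\sum_i cap i)%N.

(* The positions where [sgn j + t] is odd carry the extremal weight m - 1: all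
   pendant edges, and every second edge of an ear. *)
Definition sgn j : nat := is_pendant P j.

Definition extremal (E : {set V}) : nat :=
  (\sum_j \sum_(t < len j) ((edge j t == E) && odd (sgn j + t)) * m'.+1)%N.

Lemma extremal_edge j t : (t < len j)%N -> extremal (edge j t) = (odd (sgn j + t) * m'.+1)%N.
Proof.
move=> ht; rewrite /extremal (bigD1 j) //= (bigD1 (Ordinal ht)) //= eqxx /=.
rewrite [X in (_ + X + _)%N]big1 ?addn0; last first.
  move=> s ne; case: eqP => // /(edge_inj (ltn_ord s) ht) [_ E].
  by case/eqP: ne; apply: val_inj.
rewrite big1 ?addn0 // => i ne; apply: big1 => s _; case: eqP => //.
by move=> /(edge_inj (ltn_ord s) ht) [E]; rewrite E eqxx in ne.
Qed.

Lemma sum_odd (l : nat) : (\sum_(t < l) odd t = l./2)%N.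
Proof.
elim: l => [|l IH]; first by rewrite big_ord0.
by rewrite big_ord_recr /= IH addnC uphalf_half.
Qed.

Lemma sum_sgn j : (\sum_(t < len j) odd (sgn j + t) = cap j)%N.
Proof.
rewrite /cap /sgn; case ej: (is_ear P j).
  by rewrite ear_not_pendant //= sum_odd.
have [->|j0] := eqVneq j ord0.
  rewrite len0 big_ord0; case pj: (is_pendant P ord0) => //.
  by have := pendant_neq0 pj; rewrite eqxx.
have := ear_or_pendant j0; rewrite ej /= => pj; rewrite pj.
by have /andP[/eqP -> _] := pj; rewrite big_ord1.
Qed.

Lemma sum_extremal : (\sum_(E in edge_set e) extremal E = m'.+1 * ear_sum)%N.
Proof.
rewrite sum_edgesN /ear_sum big_distrr /=; apply: eq_bigr => j _.
rewrite -sum_sgn big_distrr /=; apply: eq_bigr => t _.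
by rewrite extremal_edge // mulnC.
Qed.

(** For o = 0, x is the residue of k; for o = 1, it is m - 1 minus that residue. In both cases k is
    at least its residue. *)
Lemma residue_shift_le (k : nat) (o : bool) (x : R) :
  x = (-1) ^+ o * (k%:R - (o * m'.+1)%:R) ->
  (o * m'.+1)%:Z + (-1) ^+ o * (x : nat)%:Z <= k%:Z.
Proof.
have hk : ((k%:R : R) <= k)%N by rewrite residue_natr leq_mod.
case: o => hx.
  have {}hx : x = - 1 - k%:R.
    rewrite hx expr1 mulN1r mul1n opprB -[m'.+1%:R](addrK 1) natr1.
    by rewrite (pchar_Zp (isT : (1 < m)%N)) sub0r.
  have aux (a b : nat) : (a + b = m'.+1)%N -> (b <= k)%N -> m'.+1%:Z - a%:Z <= k%:Z by lia.
  by rewrite hx expr1 mul1n mulN1r; apply: aux (residue_compl _) hk.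
have {}hx : x = k%:R by rewrite hx expr0 mul0n subr0 mul1r.
by rewrite hx expr0 mul0n mul1r add0r lez_nat.
Qed.

(** The difference from [extremal] is a combination of cycles with coefficients [z]. On each path
    the laminar bound gains the coefficient of the path itself, if it is an odd ear, and loses those
    of the odd ears nested in it; summed over all paths, gains and losses balance. *)
Lemma extremal_minimal (y : {set V} -> nat) :
  (forall v, bd (fun E => (y E)%:R) v = bd (fun E => (extremal E)%:R) v) ->
  (m'.+1 * ear_sum <= \sum_(E in edge_set e) y E)%N.
Proof.
move=> hy; pose c E : R := (y E)%:R - (extremal E)%:R.
have [|z hz] := @cycle_decomposition r.+1 c (fun v => bd_sub (hy v)).
  by move=> j t hj; have := ltn_ord j; rewrite ltnNge hj.
pose z0 j : R := if is_ear P j then z j else 0.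
pose L j := [seq i <- index_enum _ | is_ear P i && (par i == j)].
(* After multiplication by the sign of position t, the contribution of ear i on P_j no longer
   depends on t. *)
pose w j i : R := (-1) ^+ (eta i + sgn j + na i) * z i.
have sz0 j : (-1) ^+ sgn j * z0 j = z0 j.
  rewrite /sgn /z0; case: ifP => [ej|_]; last by rewrite mulr0.
  by rewrite ear_not_pendant // mul1r.
have memL j i : i \in L j -> is_ear P i /\ par i = j.
  by rewrite mem_filter => /andP[/andP[h /eqP]].
have cE j t : (t < len j)%N ->
    (-1) ^+ (sgn j + t) * c (edge j t) = z0 j + \sum_(i <- L j | (na i <= t < nb i)%N) w j i.
  move=> ht; rewrite hz //.
  under eq_bigr do rewrite cyc_edge // mulrDr.
  rewrite big_split /= mulrDr; congr (_ + _).
    rewrite /z0; case: ifP => ej; last first.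
      rewrite big1 ?mulr0 // => i ei; case: eqP => [E|_]; last by rewrite mulr0.
      by rewrite E ei in ej.
    rewrite (bigD1 j) //= eqxx big1; last first.
      by move=> i /andP[_ /negPf ne]; rewrite eq_sym ne mulr0.
    rewrite addr0 /sgn ear_not_pendant // mulrCA -exprD add0n -signr_odd oddD addbb.
    by rewrite mulr1.
  rewrite mulr_sumr [RHS]big_filter_cond [LHS]big_mkcond [RHS]big_mkcond /=.
  apply: eq_bigr => i _; case: ifP => //= ei; rewrite [j == _]eq_sym.
  case: eqP => //= _; last by rewrite !mulr0.
  case: ifP => _; last by rewrite !mulr0.
  rewrite /w mulrCA mulrC -exprD; congr (_ * _); rewrite -[LHS]signr_odd -[RHS]signr_odd.
  rewrite !oddD; congr (_ ^+ nat_of_bool _).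
  by case: (odd (eta i)); case: (odd (sgn j)); case: (odd t); case: (odd (na i)).
have path_bound j : (m'.+1 * cap j)%:Z + (((-1) ^+ sgn j *+ odd (len j)) * (z0 j : nat)%:Z
    - \sum_(i <- L j | odd (nb i - na i)) (z i : nat)%:Z) <=
    (\sum_(t < len j) y (edge j t))%:Z.
  have h1 i : i \in L j -> (na i <= nb i <= len j)%N.
    by case/memL => /nested [_ ? _] <-.
  have h2 i : i \in L j -> odd (nb i - na i) -> w j i = - (-1) ^+ (sgn j + na i) * z i.
    case/memL => ei _ oi; have [_ /andP[ab _] _] := nested ei.
    move: oi; rewrite /w /eta -(odd_nest ei) oddB // addbC -oddD => ->.
    by rewrite -addnA exprD expr1 mulN1r.
  have h3 i l : i \in L j -> l \in L j -> laminar na nb i l.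
    by case/memL => ei Ei; case/memL => el El; apply: lam => //; rewrite El.
  have := laminar_alternating_bound (z0 j) h1 h2 h3.
  set A := \sum_(_ <= _ < _) _; set B := \sum_(_ <- _ | _) _.
  have hA : (m'.+1 * cap j)%:Z + A <= (\sum_(t < len j) y (edge j t))%:Z.
    rewrite -sum_sgn big_distrr /= /A big_mkord !(big_morph Posz PoszD (erefl _)).
    rewrite -big_split; apply: ler_sum => t _; cbv beta.
    rewrite -cE // /c extremal_edge // mulnC -[(-1 : int) ^+ _]signr_odd -[(-1 : R) ^+ _]signr_odd.
    exact: (residue_shift_le (erefl _)).
  by lia.
rewrite sum_edgesN -lez_nat (big_morph Posz PoszD (erefl _)).
apply: le_trans (ler_sum _ (fun j _ => path_bound j)).
rewrite big_split /= sumrB -(big_morph Posz PoszD (erefl _)) /ear_sum -big_distrr /=.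
(* Every odd ear is lost once, on its parent, and gained once, on itself. *)
rewrite lerDl subr_ge0.
rewrite [leRHS](_ : _ = \sum_(j | is_ear P j) (odd (len j) * z j)%N%:Z); last first.
  rewrite [RHS]big_mkcond /=; apply: eq_bigr => j _.
  rewrite /z0 /sgn; case: ifP => [ej|_]; last by rewrite mulr0.
  by rewrite ear_not_pendant // expr0 PoszM -mulr_natl mulr1 natz.
rewrite [leRHS](partition_big par xpredT) //=; apply: ler_sum => j _.
rewrite big_filter_cond [leRHS]big_mkcond [leLHS]big_mkcond /=; apply: ler_sum => i _.
case: ifP => [/andP[/andP[ei ->] oi]|_]; last by case: ifP.
rewrite ei /=; have [_ /andP[ab _] _] := nested ei.
by move: oi; rewrite oddB // addbC -oddD (odd_nest ei) => ->; rewrite mul1n.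
Qed.

(** The paths are treated from the last to the first. A multiple of [cyc i] changes only P_i and an
    earlier path, so the bounds already reached persist; a pendant edge never exceeds m - 1. *)
Lemma small_representative c : exists y : {set V} -> R,
  (forall v, bd y v = bd c v) /\ (\sum_(E in edge_set e) y E <= m'.+1 * ear_sum)%N.
Proof.
suff H k : (k <= r.+1)%N -> exists y : {set V} -> R, (forall v, bd y v = bd c v) /\
    forall j, (r.+1 - k <= j)%N -> (\sum_(t < len j) y (edge j t) <= m'.+1 * cap j)%N.
  have [y [hy hs]] := H _ (leqnn _); exists y; split=> //.
  rewrite sum_edgesN /ear_sum big_distrr /=.
  by apply: leq_sum => j _; apply: hs; rewrite subnn.
elim: k => [_|k IH hk].
  by exists c; split=> // j; rewrite subn0 leqNgt ltn_ord.
have [y [hy hs]] := IH (ltnW hk).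
have lt : (r.+1 - k.+1 < r.+1)%N by rewrite ltn_subrL.
pose i := Ordinal lt.
have hsi j : (i < j)%N -> (\sum_(t < len j) y (edge j t) <= m'.+1 * cap j)%N.
  by move=> hj; apply: hs; rewrite subnSK in hj.
case ei: (is_ear P i); last first.
  exists y; split=> // j; rewrite leq_eqVlt => /orP[/eqP ij|]; last exact: hsi.
  have {ij} E : i = j by apply: ord_inj.
  rewrite -E /cap ei; have [->|i0] := eqVneq i ord0; first by rewrite len0 big_ord0.
  have := ear_or_pendant i0; rewrite ei /= => pi; rewrite pi muln1.
  by have /andP[/eqP -> _] := pi; rewrite big_ord1 -ltnS ltn_residue.
have [z hz] := alternating_shift_bound (len i) (fun t => y (edge i t)).
have [pi _ _] := nested ei.
exists (fun E => y E + z * cyc i E); split=> [v|j].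
  by rewrite bd_linear bd_cyc // mulr0 addr0.
rewrite leq_eqVlt => /orP[/eqP ij|hj].
  have {ij} E : i = j by apply: ord_inj.
  rewrite -E /cap ei; apply: leq_trans hz; apply: leq_sum => t _.
  by rewrite cyc_edge // eqxx -[i == _]val_eqE (gtn_eqF pi) addr0 mulrC.
apply: leq_trans (hsi j hj); apply: leq_sum => t _.
by rewrite cyc_edge // -!val_eqE (gtn_eqF hj) (gtn_eqF (ltn_trans pi hj)) addr0 mulr0 addr0.
Qed.

(* Summing the boundary over one side of the bipartition counts every edge once. *)
Lemma bd_total c d : (forall v, bd c v = bd d v) ->
  \sum_(E in edge_set e) c E = \sum_(E in edge_set e) d E.
Proof.
suff tot f : \sum_(v | side v) bd f v = \sum_(E in edge_set e) f E.
  by move=> h; rewrite -!tot; apply: eq_bigr => v _; rewrite h.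
under eq_bigr do rewrite bdE.
rewrite exchange_big sum_edges; apply: eq_bigr => i _.
rewrite exchange_big; apply: eq_bigr => t _; rewrite sumrMnr.
rewrite (_ : (\sum_(v | side v) (v \in edge i t) = 1)%N) //.
under eq_bigr do rewrite mem_edge //.
have cnt (w : V) : (\sum_(v | side v) (v == w) = side w)%N.
  rewrite big_mkcond (bigD1 w) //= eqxx big1 ?addn0; first by case: side.
  by move=> v /negPf ->; rewrite if_same.
rewrite big_split /= !cnt; have := side_e (edge_adj (ltn_ord t)).
by case: side; case: side.
Qed.

End Cycles.

(** The edges of a path are distinct, so disjointness and inclusion of edge sets translate into
    positions. *)
Lemma nesting_intervals : exists (par : 'I_r.+1 -> 'I_r.+1) (na nb : 'I_r.+1 -> nat),
  (forall i, is_ear P i ->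
    [/\ (par i < i)%N, (na i <= nb i <= len (par i))%N
      & if src (P i) == tgt (P i) then na i = 0%N /\ nb i = 0%N
        else [set vert (par i) (na i); vert (par i) (nb i)] = [set src (P i); tgt (P i)]]) /\
  (forall i l, is_ear P i -> is_ear P l -> par i = par l -> laminar na nb i l).
Proof.
case: decP => _ _ _ _ [N [hN1 hN2]].
have /fin_all_exists [f hf] i : exists d : 'I_r.+1 * (nat * nat), is_ear P i ->
    [/\ ends_in P i d.1, (d.2.1 <= d.2.2 <= len d.1)%N,
      if src (P i) == tgt (P i) then d.2.1 = 0%N /\ d.2.2 = 0%N
      else [set vert d.1 d.2.1; vert d.1 d.2.2] = [set src (P i); tgt (P i)]
    & forall t, (t < len d.1)%N -> (edge d.1 t \in N i d.1) = (d.2.1 <= t < d.2.2)%N].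
  case ei: (is_ear P i); last by exists (i, (0, 0))%N.
  have /andP[/existsP[j hj] _] := ei; have := hN1 i j hj; rewrite /nest_interval.
  case: ifP => [_ N0|ne [a [b [/andP[ab bl] hs NE]]]].
    by exists (j, (0, 0))%N => _; split=> // t _; rewrite N0 inE.
  exists (j, (a, b)) => _; split=> //=; first by rewrite (ltnW ab).
  move=> t ht; rewrite NE inE.
  have /and5P[_ _ _ _ hu] := graph_pathP (ord0_of_len ht).
  have sz : size (take b (pedges (P j))) = b.
    by rewrite size_takel // size_pedges.
  apply/(nthP set0)/idP => [[s]|/andP[at_ tb]].
    rewrite size_drop sz nth_drop => hs' E.
    rewrite nth_take in E; last by lia.
    have : edge j (a + s) = edge j t by [].
    by case/edge_inj => // [|_ <-]; lia.
  exists (t - a)%N; first by rewrite size_drop sz; lia.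
  by rewrite nth_drop subnKC // nth_take.
exists (fun i => (f i).1), (fun i => (f i).2.1), (fun i => (f i).2.2); split.
  by move=> i ei; have [/and3P[h1 _ _] h2 h3 _] := hf i ei.
move=> i l ei el pE; have [h1 /andP[h2 h2'] _ h3] := hf i ei.
have [h4 /andP[h5 h5'] _ h6] := hf l el; rewrite /laminar.
rewrite -pE in h4 h5' h6.
move: h2 h2' h3 h5 h5' h6; set j := (f i).1 in h1 h4 *.
move: (f i).2.1 (f i).2.2 (f l).2.1 (f l).2.2 => a b a' b' ab bl h3 ab' bl' h6.
(* Empty intervals are compared directly, since their edge sets carry no position. *)
have [E|ne] := eqVneq a b.
  have [h|h] := leqP a a'; first by constructor 1; rewrite -E.
  by have [h'|h'] := leqP b' a; [constructor 2 | constructor 4; lia].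
have [E|ne'] := eqVneq a' b'.
  have [h|h] := leqP a' a; first by constructor 2; rewrite -E.
  by have [h'|h'] := leqP b a'; [constructor 1 | constructor 3; lia].
case/or3P: (hN2 i l j h1 h4) => hN.
- have [h|h] := leqP b a'; first by constructor 1.
  have [h'|h'] := leqP b' a; first by constructor 2.
  have ht : (maxn a a' < len j)%N by lia.
  have /pred0P /(_ (edge j (maxn a a'))) /= := hN.
  by rewrite h3 // h6 // leq_maxl leq_maxr !gtn_max /=; lia.
- have hsub t : (a <= t < b)%N -> (a' <= t < b')%N.
    by move=> ht; have hl : (t < len j)%N by [lia]; rewrite -h6 // (subsetP hN) // h3.
  by constructor 4; have := hsub a; have := hsub b.-1; lia.
have hsub t : (a' <= t < b')%N -> (a <= t < b)%N.
  by move=> ht; have hl : (t < len j)%N by [lia]; rewrite -h3 // (subsetP hN) // h6.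
by constructor 3; have := hsub a'; have := hsub b'.-1; lia.
Qed.

Lemma card_new_ord0 : #|new_verts ord0| = 1%N.
Proof.
have vE : verts (P ord0) = [:: src (P ord0)].
  by move: len0; rewrite /plen /verts; case: (P ord0) => x [].
rewrite (_ : new_verts ord0 = [set src (P ord0)]) ?cards1 //.
apply/setP => v; rewrite in_set vE mem_seq1 in_set1 in_set andbC; case: existsP => // -[j /andP[]].
by rewrite ltn0.
Qed.

(** Path by path: an ear of length l brings l - 1 new vertices, plus 1 if l is even, hence 2
    floor(l/2); a pendant edge brings 1 + 1; P_0 gives the last 1. *)
Lemma card_ears : (#|V| + num_even_ears_and_pendants P = ear_sum.*2.+1)%N.
Proof.
rewrite card_verts /num_even_ears_and_pendants -[X in (_ + X)%N]sum1_card
  [X in (_ + X)%N]big_mkcond /= -big_split /=.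
have e0 : is_ear P ord0 = false by apply/negP => /ear_neq0; rewrite eqxx.
have p0 : is_pendant P ord0 = false by apply/negP => /pendant_neq0; rewrite eqxx.
rewrite (bigD1 ord0) //= card_new_ord0 inE e0 p0 /= addn0 add1n; congr _.+1.
rewrite /ear_sum -muln2 big_distrl /= [RHS](bigD1 ord0) //= {1}/cap e0 p0 mul0n add0n.
apply: eq_bigr => i i0; rewrite inE /cap; have := ear_or_pendant i0.
have [ei _|ei /= pi] := boolP (is_ear P i).
  rewrite card_new_ear // ear_not_pendant // orbF.
  by have := len_gt0 i0; rewrite /=; case: ifP; have := odd_double_half (len i); lia.
by have [v _ ->] := pendant_new pi; rewrite pi cards1.
Qed.

End Ears.

Theorem ear_decomposition_weights (V : finType) (e : rel V) (r : nat)
    (P : 'I_r.+1 -> vpath V) (m' : nat) :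
  simple_graph e -> no_isolated_vertex e -> bipartite e ->
  weak_nested_ear_decomposition P e ->
  exists N (x0 : {set V} -> nat),
  [/\ (#|V| + num_even_ears_and_pendants P = N.*2.+1)%N,
      forall c : {set V} -> 'Z_m'.+2, exists y : {set V} -> 'Z_m'.+2,
        (forall v, bd e y v = bd e c v) /\ (\sum_(E in edge_set e) y E <= m'.+1 * N)%N,
      (\sum_(E in edge_set e) x0 E = m'.+1 * N)%N,
      forall y : {set V} -> nat,
        (forall v, bd e (fun E => (y E)%:R : 'Z_m'.+2) v = bd e (fun E => (x0 E)%:R) v) ->
        (m'.+1 * N <= \sum_(E in edge_set e) y E)%N
    & forall c d : {set V} -> 'Z_m'.+2, (forall v, bd e c v = bd e d v) ->
        \sum_(E in edge_set e) c E = \sum_(E in edge_set e) d E].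
Proof.
move=> e_simple e_noisol [side side_e] decP.
have [par [na [nb [nested lam]]]] := nesting_intervals decP.
exists (ear_sum P), (extremal P m'); split.
- exact: card_ears e_noisol decP.
- exact: (small_representative e_simple decP side_e nested).
- exact: sum_extremal.
- exact: (extremal_minimal e_simple decP side_e nested lam).
- exact: (bd_total e_simple decP side_e).
Qed.

(** * The vanishing ideal *)

Section TorusSums.
Variable K : finFieldType.
Hypothesis K_gt2 : (2 < #|K|)%N.
Local Notation q1 := (#|K|.-1).

Lemma torus_expr (x : K) : x != 0 -> x ^+ q1 = 1.
Proof.
move=> x0; apply: (mulfI x0); rewrite mulr1 -exprS prednK ?expf_card //.
exact: leq_trans K_gt2.
Qed.

Lemma torus_expr_mod (x : K) (k : nat) : x != 0 -> x ^+ k = x ^+ (k %% q1).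
Proof. by move=> x0; rewrite {1}(divn_eq k q1) exprD mulnC exprM torus_expr // expr1n mul1r. Qed.

(** Orthogonality of characters: if q - 1 does not divide k, some g has g^k != 1, as x^k = 1 has too
    few roots, and multiplication by g permutes the sum. Otherwise the sum is q - 1 = -1. *)
Lemma sum_torus_expr (k : nat) :
  \sum_(x : K | x != 0) x ^+ k = if (q1 %| k)%N then -1 else 0.
Proof.
have cardK : #|[pred x : K | x != 0]| = q1.
  by rewrite (cardC1 (0 : K)).
case: ifP => [/dvdnP[c ->]|ndv].
  under eq_bigr => x x0 do rewrite mulnC exprM torus_expr // expr1n.
  rewrite sumr_const cardK; apply/eqP; rewrite -subr_eq0 opprK -mulrSr.
  rewrite prednK ?(leq_trans _ K_gt2) //.
  by apply/eqP; have := @expg_cardG K [set: K]%G (1 : K)%R (in_setT _); rewrite cardsT.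
have [g g0 gk] : exists2 g : K, g != 0 & g ^+ k != 1.
  have [//|no] := classic (exists2 g : K, g != 0 & g ^+ k != 1).
  have q1_gt0 : (0 < q1)%N by rewrite -ltnS prednK ?(leq_trans _ K_gt2).
  have k0 : (0 < k %% q1)%N by rewrite lt0n; apply: contraFN ndv.
  have := @max_unity_roots K _ (enum [pred x : K | x != 0]) k0 _ (enum_uniq _).
  rewrite -cardE cardK leqNgt ltn_mod q1_gt0 => h; case: notF; apply: h.
  apply/allP => x; rewrite mem_enum inE => x0; apply/unity_rootP.
  rewrite -torus_expr_mod //; apply/eqP; apply: contraT => xk.
  by case: no; exists x.
have: g ^+ k * (\sum_(x : K | x != 0) x ^+ k) = \sum_(x : K | x != 0) x ^+ k.
  rewrite mulr_sumr [RHS](reindex_inj (mulfI g0)) /=.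
  by apply: eq_big => x; rewrite ?mulf_eq0 ?negb_or ?g0 // exprMn.
move/eqP; rewrite -subr_eq0 -{2}[\sum_(_ | _) _]mul1r -mulrBl mulf_eq0 subr_eq0 (negPf gk).
by move/eqP.
Qed.
End TorusSums.

Section VanishingIdeal.
Variables (K : finFieldType) (V : finType) (e : rel V).
Hypothesis K_gt2 : (2 < #|K|)%N.
Local Notation n := #|edge_set e|.
Local Notation S := {mpoly K[n]}.
Local Notation I := (@vanishing_ideal K V e).
Local Notation m' := (#|K| - 3)%N.
Local Notation R := 'Z_m'.+2.
Implicit Types (p f : S) (mu nu : 'X_{1..n}) (a : V -> K).

Let q1E : #|K|.-1 = m'.+2.
Proof. by move: K_gt2; lia. Qed.

Definition torus_point a (k : 'I_n) : K := \prod_(v in (enum_val k : {set V})) a v.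

Lemma torus_point_neq0 a k : (forall v, a v != 0) -> torus_point a k != 0.
Proof. by move=> ha; apply/prodf_neq0. Qed.

Definition vdeg mu (v : V) : nat := (\sum_(k < n | v \in (enum_val k : {set V})) mu k)%N.

Lemma vdegD mu nu v : vdeg (mu + nu)%MM v = (vdeg mu v + vdeg nu v)%N.
Proof. by rewrite /vdeg -big_split; apply: eq_bigr => k _; rewrite mnmDE. Qed.

Lemma eval_monomial a mu : ('X_[mu] : S).@[torus_point a] = \prod_v a v ^+ vdeg mu v.
Proof.
rewrite mevalX.
transitivity (\prod_(k < n) \prod_(v in (enum_val k : {set V})) a v ^+ mu k).
  by apply: eq_bigr => k _; rewrite prodrXl.
rewrite (exchange_big_dep xpredT) //=; apply: eq_bigr => v _.
exact: prodrXr.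
Qed.

Definition vcong mu nu := forall v, (vdeg mu v)%:R = (vdeg nu v)%:R :> R.

Lemma natr_modE (k l : nat) : (k%:R == l%:R :> R) = (k == l %[mod m'.+2])%N.
Proof. by rewrite -val_eqE /= !residue_natr. Qed.

Lemma eval_vcong a mu nu : (forall v, a v != 0) -> vcong mu nu ->
  ('X_[mu] : S).@[torus_point a] = ('X_[nu] : S).@[torus_point a].
Proof.
move=> ha h; rewrite !eval_monomial; apply: eq_bigr => v _.
have /eqP := h v; rewrite natr_modE => /eqP E.
by rewrite (torus_expr_mod K_gt2) // q1E E -q1E -torus_expr_mod.
Qed.

(* Pairing with a character of the torus: it kills the vanishing ideal and
   separates the classes of monomials. *)
Definition torus_char (al : V -> nat) p : K :=
  \sum_(a : {ffun V -> K} | a \in ffun_on [pred x | x != 0])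
    p.@[torus_point a] * \prod_v a v ^+ al v.

Lemma torus_charD al p f : torus_char al (p + f) = torus_char al p + torus_char al f.
Proof.
by rewrite /torus_char -big_split; apply: eq_bigr => a _; rewrite mevalD mulrDl.
Qed.

Lemma torus_charZ al c p : torus_char al (c *: p) = c * torus_char al p.
Proof.
by rewrite /torus_char mulr_sumr; apply: eq_bigr => a _; rewrite mevalZ mulrA.
Qed.

Lemma torus_char_vanishing al p : vanishes_on_torus p -> torus_char al p = 0.
Proof.
move=> vp; apply: big1 => a /ffun_onP ha.
by rewrite [p.@[_]](vp a (fun v => ha v)) mul0r.
Qed.

Lemma torus_char_monomial al mu : torus_char al 'X_[mu] =
  \prod_v (if (#|K|.-1 %| vdeg mu v + al v)%N then -1 else 0).
Proof.
under [RHS]eq_bigr do rewrite -(sum_torus_expr K_gt2).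
rewrite (bigA_distr_big (fun x : K => x != 0) (fun v (x : K) => x ^+ (vdeg mu v + al v))).
apply: eq_bigr => a _; rewrite (eval_monomial a) -big_split.
by apply: eq_bigr => v _; rewrite exprD.
Qed.

Lemma vanishing_ideal_vanishes p : I p -> vanishes_on_torus p.
Proof.
move=> [s [hs ->]] a ha; rewrite raddf_sum big1_seq // => -[f g] /= /hs[_ hg].
by rewrite mevalM (hg a ha) mulr0.
Qed.

Lemma dhomog_ghom d p : reflect (ghom d%:Z p) (p \is d.-homog).
Proof.
apply: (iffP (dhomogP _ _ _)) => h m; first by rewrite -mcoeff_msupp => /h ->.
by rewrite mcoeff_msupp => /h [].
Qed.

Lemma vanishing_idealD p f : I p -> I f -> I (p + f).
Proof.
move=> [s [hs ->]] [t [ht ->]]; exists (s ++ t); split; last by rewrite big_cat.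
by move=> x; rewrite mem_cat => /orP[/hs|/ht].
Qed.

Lemma vanishing_ideal0 : I 0.
Proof. by exists [::]; split=> //; rewrite big_nil. Qed.

Lemma vanishing_idealM p f : I f -> I (p * f).
Proof.
move=> [s [hs ->]]; exists [seq (p * x.1, x.2) | x <- s]; split.
  by move=> x /mapP[y /hs hy ->].
by rewrite big_map mulr_sumr; apply: eq_bigr => x _; rewrite mulrA.
Qed.

Lemma vanishing_ideal_gen d p : ghom d p -> vanishes_on_torus p -> I p.
Proof.
move=> hp vp; have [->|p0] := eqVneq p 0; first exact: vanishing_ideal0.
exists [:: (1, p)]; split; last by rewrite big_seq1 mul1r.
move=> x; rewrite inE => /eqP -> /=; split=> //.
have := mlead_supp p0; rewrite mcoeff_msupp => /hp E.
by exists (mdeg (mlead p)); apply/dhomog_ghom; rewrite E.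
Qed.

Lemma vanishing_ideal_sum (J : Type) (s : seq J) (P : pred J) (F : J -> S) :
  (forall j, P j -> I (F j)) -> I (\sum_(j <- s | P j) F j).
Proof.
by move=> h; elim/big_ind: _ => //; [exact: vanishing_ideal0 | exact: vanishing_idealD].
Qed.

Lemma vanishing_ideal_hcomp d p : I p -> I (hcomp d p).
Proof.
move=> [s [hs ->]]; rewrite hcomp_sum big_seq; apply: vanishing_ideal_sum => -[f g] /hs /=.
move=> [[k /dhomog_ghom hg] vg]; rewrite (hcompMr _ _ hg).
by apply/vanishing_idealM/(vanishing_ideal_gen hg).
Qed.

Lemma vanishing_ideal_const d p : ghom d p -> I p -> p@_0%MM = 0.
Proof.
move=> hp /vanishing_ideal_vanishes vp; apply/eqP; apply: contraT => p0.
have d0 : d = 0 by rewrite -(hp _ p0) mdeg0.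
have pE : p = (p@_0%MM)%:MP.
  apply/mpolyP => m; rewrite mcoeffC; case: (eqVneq m 0%MM) => [->|ne].
    by rewrite mulr1.
  rewrite mulr0; apply: contraNeq ne => /hp.
  by rewrite d0 => /eqP; rewrite eqz_nat mdeg_eq0.
have := vp (fun=> 1) (fun=> oner_neq0 _); rewrite pE mevalC => E.
by rewrite E eqxx in p0.
Qed.

(** The variables never vanish on the torus. Passing to homogeneous components is necessary because
    vanishing gives membership only for homogeneous polynomials. *)
Lemma vanishing_ideal_mulXI (k : 'I_n) p : I ('X_k * p) -> I p.
Proof.
move=> hp; have [s [_ -> _]] := hcomp_part p.
apply: vanishing_ideal_sum => d _.
have hX : ghom 1 ('X_k : S) by have := @ghomX K n U_(k)%MM; rewrite mdeg1.
have := @vanishing_ideal_hcomp (d + 1) _ hp.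
rewrite mulrC (hcompMr _ _ hX) addrK => /vanishing_ideal_vanishes v.
apply: (vanishing_ideal_gen (@ghom_hcomp _ _ d p)) => a ha.
have /eqP := v a ha; rewrite mevalM mulf_eq0 => /orP[/eqP //|].
by rewrite mevalXU (negPf (torus_point_neq0 k ha)).
Qed.

Lemma vcong_sub mu nu : mdeg mu = mdeg nu -> vcong mu nu -> I ('X_[mu] - 'X_[nu]).
Proof.
move=> hd h; apply: (@vanishing_ideal_gen (mdeg mu)%:Z).
  by apply: ghomD; [|apply: ghomN; rewrite hd]; apply: ghomX.
by move=> a ha; rewrite mevalB (eval_vcong ha h) subrr.
Qed.

Definition edge_weights mu (E : {set V}) : nat := (\sum_(k < n | enum_val k == E) mu k)%N.

Lemma edge_weights_val mu k : edge_weights mu (enum_val k) = mu k.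
Proof.
by rewrite /edge_weights (eq_bigl (pred1 k)) ?big_pred1_eq // => l; rewrite (inj_eq enum_val_inj).
Qed.

Lemma mdeg_edge_weights mu : mdeg mu = (\sum_(E in edge_set e) edge_weights mu E)%N.
Proof.
by rewrite mdegE [RHS]big_enum_val; apply: eq_bigr => k _; rewrite edge_weights_val.
Qed.

Lemma bd_edge_weights mu v : bd e (fun E => (edge_weights mu E)%:R : R) v = (vdeg mu v)%:R.
Proof.
rewrite /bd big_enum_val_cond /vdeg natr_sum.
by apply: eq_bigr => k _; rewrite edge_weights_val.
Qed.

Definition edge_mnm (y : {set V} -> nat) : 'X_{1..n} := [multinom y (enum_val k) | k < n].

Lemma mdeg_edge_mnm y : mdeg (edge_mnm y) = (\sum_(E in edge_set e) y E)%N.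
Proof. by rewrite mdegE [RHS]big_enum_val; apply: eq_bigr => k _; rewrite mnmE. Qed.

Lemma vdeg_edge_mnm y v : (vdeg (edge_mnm y) v)%:R = bd e (fun E => (y E)%:R : R) v.
Proof.
rewrite /bd big_enum_val_cond /vdeg natr_sum.
by apply: eq_bigr => k _; rewrite mnmE.
Qed.

Variables (N : nat) (x0 : {set V} -> nat) (k0 : 'I_n).
Hypothesis N_gt0 : (0 < N)%N.
Hypothesis small_rep : forall c : {set V} -> R, exists y : {set V} -> R,
  (forall v, bd e y v = bd e c v) /\ (\sum_(E in edge_set e) y E <= m'.+1 * N)%N.
Hypothesis x0_weight : (\sum_(E in edge_set e) x0 E = m'.+1 * N)%N.
Hypothesis x0_minimal : forall y : {set V} -> nat,
  (forall v, bd e (fun E => (y E)%:R : R) v = bd e (fun E => (x0 E)%:R) v) ->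
  (m'.+1 * N <= \sum_(E in edge_set e) y E)%N.
Hypothesis bd_total : forall c d : {set V} -> R, (forall v, bd e c v = bd e d v) ->
  \sum_(E in edge_set e) c E = \sum_(E in edge_set e) d E.
Hypothesis k0_first : k0 = 0%N :> nat.
Local Notation rho := (N.-1 * m'.+1)%N.

(** A small representative has weight w congruent to D modulo m. If w > D, then w >= D + m > N(m -
    1), which is impossible; the missing D - w, a multiple of m, is placed on edge [k0] without
    changing the class. *)
Lemma representative (c : {set V} -> R) (D : nat) :
  D%:R = \sum_(E in edge_set e) c E -> (rho <= D)%N ->
  exists nu, mdeg nu = D /\ forall v, (vdeg nu v)%:R = bd e c v.
Proof.
move=> hD le; have [y [hy hw]] := small_rep c.
set w := (\sum_(E in edge_set e) y E)%N in hw.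
have wD : (w %% m'.+2 = D %% m'.+2)%N.
  apply/eqP; rewrite -natr_modE hD -(bd_total hy) /w natr_sum.
  by apply/eqP; apply: eq_bigr => E _; rewrite natr_Zp.
have lewD : (w <= D)%N.
  rewrite leqNgt; apply/negP => lt.
  have : (w < D + m'.+2)%N.
    apply: (leq_ltn_trans hw); apply: (@leq_ltn_trans (D + m'.+1)); last by rewrite ltn_add2l.
    by apply: leq_trans (leq_add le (leqnn _)); rewrite -mulSnr prednK // mulnC.
  have /eqP := wD; rewrite (eqn_mod_dvd _ (ltnW lt)) => /dvdn_leq h1 h2.
  by have := h1 _; rewrite subn_gt0 => /(_ lt); lia.
pose z E := (y E + (if E == enum_val k0 then D - w else 0))%N.
exists (edge_mnm z); split.
  rewrite mdeg_edge_mnm /z big_split /= -/w -[RHS](subnKC lewD); congr (_ + _)%N.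
  rewrite (bigD1 (enum_val k0)) ?enum_valP //= eqxx big1 ?addn0 //.
  by move=> E /andP[_ /negPf ->].
move=> v; rewrite vdeg_edge_mnm -hy; apply: eq_bigr => E _.
rewrite /z natrD natr_Zp; case: eqP => _; rewrite ?addr0 //.
rewrite natrB //; have /eqP -> : D%:R == w%:R :> R by rewrite natr_modE wD.
by rewrite subrr addr0.
Qed.

Let in_sum := @in_sum_X0 K n I.

Let xvar0 : xvar K n 0 = 'X_k0.
Proof. by rewrite -k0_first xvarE. Qed.

(** The class of mu divided by X_0 has a representative nu of degree one less, so mu and X_0 nu
    agree modulo I. *)
Lemma in_sum_monomial mu : (rho < mdeg mu)%N -> in_sum (mdeg mu)%:Z 'X_[mu].
Proof.
move=> lt.
pose c E : R := (edge_weights mu E)%:R + (-1) * (edge_weights U_(k0)%MM E)%:R.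
have [||nu [dnu hnu]] := @representative c (mdeg mu).-1.
- rewrite big_split /= -mulr_sumr -!natr_sum -!mdeg_edge_weights mdeg1 mulN1r.
  by rewrite -[in RHS](@prednK (mdeg mu)) ?(leq_trans _ lt) // -natr1 addrK.
- by rewrite -ltnS prednK // (leq_trans _ lt).
have dE : mdeg mu = mdeg (U_(k0) + nu)%MM.
  by rewrite mdegD mdeg1 dnu add1n prednK // (leq_trans _ lt).
exists ('X_[mu] - 'X_[(U_(k0) + nu)]), 'X_[nu]; split.
- by apply: ghomD; [|apply: ghomN; rewrite dE]; apply: ghomX.
- apply: vcong_sub => // v; rewrite vdegD natrD hnu bd_linear !bd_edge_weights.
  by rewrite mulN1r addrC subrK.
- by rewrite dE mdegD mdeg1 addnC PoszD addrK; apply: ghomX.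
by rewrite xvar0 -mpolyXD subrK.
Qed.

Lemma in_sum_high d p : rho%:Z < d -> ghom d p -> in_sum d p.
Proof.
move=> lt hp; rewrite [p]mpolyE big_seq.
apply: (big_ind (in_sum d)).
- exists 0, 0; split; [exact: ghom0 | exact: vanishing_ideal0 | exact: ghom0 |].
  by rewrite mulr0 addr0.
- move=> _ _ [z [f [hz Iz hf ->]]] [z' [f' [hz' Iz' hf' ->]]].
  exists (z + z'), (f + f'); split; [exact: ghomD | exact: vanishing_idealD | exact: ghomD |].
  by rewrite mulrDr addrACA.
move=> mu; rewrite mcoeff_msupp => /hp dE.
have [|z [f [hz Iz hf E]]] := @in_sum_monomial mu; first by rewrite -dE ltz_nat in lt.
rewrite dE in hz hf.
exists (p@_mu *: z), (p@_mu *: f); split; [exact: ghomZ | | exact: ghomZ |].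
  by rewrite -mul_mpolyC; apply: vanishing_idealM.
by rewrite -scalerAr -scalerDr -E.
Qed.

(** Take mu in the class of X_0 times the extremal labelling. If mu were in I + (X_0), some X_0 nu
    would have its class, and nu would have the extremal class in degree rho - 1 < N(m - 1). *)
Lemma not_in_sum_top : exists2 s, ghom rho%:Z s & ~ in_sum rho%:Z s.
Proof.
pose c E : R := (x0 E)%:R + 1 * (edge_weights U_(k0)%MM E)%:R.
have [||mu [dmu hmu]] := @representative c rho; last 1 first.
- exists 'X_[mu]; first by rewrite -dmu; apply: ghomX.
  move=> [z [f [_ Iz hf E]]].
  (* The exponents are the negatives of those of mu modulo m, so this character detects exactly the
     class of mu. *)
  pose al v := (m'.+1 * vdeg mu v)%N.
  have : torus_char al ('X_[mu] : S) != 0.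
    rewrite torus_char_monomial //; apply/prodf_neq0 => v _.
    by rewrite q1E -mulSn dvdn_mulr // oppr_eq0 oner_neq0.
  rewrite E torus_charD torus_char_vanishing ?add0r; last exact: vanishing_ideal_vanishes.
  rewrite xvar0 [f]mpolyE mulr_sumr big_seq.
  suff -> : torus_char al (\sum_(nu <- msupp f | nu \in msupp f) 'X_k0 * (f@_nu *: 'X_[nu])) = 0.
    by rewrite eqxx.
  apply: (big_ind (fun p => torus_char al p = 0)).
  + by rewrite -(scale0r (0 : S)) torus_charZ mul0r.
  + by move=> p1 p2 h1 h2; rewrite torus_charD h1 h2 addr0.
  move=> nu; rewrite mcoeff_msupp => /hf dnu.
  rewrite -scalerAr torus_charZ -mpolyXD torus_char_monomial //.
  apply/eqP; rewrite mulf_eq0; apply/orP; right; apply: contraT => /prodf_neq0 h.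
  have hc v : (vdeg nu v)%:R = bd e (fun E => (x0 E)%:R : R) v.
    have := h v isT; case: ifP => [hd _|]; last by rewrite eqxx.
    rewrite q1E vdegD /al in hd.
    have : ((vdeg U_(k0)%MM v + vdeg nu v + m'.+1 * vdeg mu v)%N%:R : R) = 0.
      by apply/eqP; rewrite -[0](mulr0n 1) natr_modE mod0n -/(dvdn _ _).
    rewrite natrD natrM hmu /c bd_linear mul1r bd_edge_weights natrD.
    have -> : m'.+1%:R = -1 :> R.
      by apply/eqP; rewrite -subr_eq0 opprK natr1 (pchar_Zp (isT : (1 < m'.+2)%N)).
    move/eqP; rewrite mulN1r subr_eq0 addrC => /eqP /addIr ->.
    by [].
  have := @x0_minimal (edge_weights nu) _; rewrite -mdeg_edge_weights => /(_ _) hmin.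
  have : (m'.+1 * N <= mdeg nu)%N by apply: hmin => v; rewrite bd_edge_weights.
  have : (mdeg nu < rho)%N by rewrite -ltz_nat dnu; lia.
  move=> lt le; have := leq_ltn_trans le lt; rewrite mulnC ltn_mul2r [(N < _)%N]ltnNge.
  by rewrite leq_pred andbF.
(* The total weight N(m - 1) + 1 is congruent to rho, as rho = N(m - 1) + 1 - m. *)
- rewrite big_split /= -mulr_sumr -!natr_sum -mdeg_edge_weights mdeg1 x0_weight mul1r.
  apply/eqP; rewrite -natrD natr_modE mulnC -{2}(prednK N_gt0) mulnS.
  by rewrite addnAC addn1 mulnC modnDl.
exact: leqnn.
Qed.

Theorem regularity_vanishing_ideal : is_regularity I rho%:Z.
Proof.
apply: regularity_criterion.
- exact: vanishing_ideal0.
- exact: vanishing_idealD.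
- exact: vanishing_idealM.
- exact: vanishing_ideal_hcomp.
- exact: vanishing_ideal_const.
- by case: k0 => k /(leq_trans _); apply.
- by move=> p; rewrite xvar0; apply: vanishing_ideal_mulXI.
- exact: in_sum_high.
- exact: not_in_sum_top.
Qed.

End VanishingIdeal.

Theorem theorem4p4 (K : finFieldType) (hK : (2 < #|K|)%N)
    (V : finType) (e : rel V)
    (he : simple_graph e) (hiso : no_isolated_vertex e) (hbip : bipartite e)
    (r : nat) (P : 'I_r.+1 -> vpath V)
    (hP : weak_nested_ear_decomposition P e) :
  exists rho : int,
    is_regularity (@vanishing_ideal K V e) rho /\
    (rho%:~R : rat) =
      (#|V|%:R + (num_even_ears_and_pendants P)%:R - 3) / 2 * (#|K|%:R - 2).
Proof.
have [N [x0 [cardN small x0w x0min tot]]] :=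
  ear_decomposition_weights (#|K| - 3) he hiso hbip hP.
have [u [v euv]] : exists u v, e u v.
  have [v vs] : exists v, v = src (P ord0) by exists (src (P ord0)).
  by have [w hw] := hiso v; exists v, w.
have n_gt0 : (0 < #|edge_set e|)%N.
  apply/card_gt0P; exists [set u; v]; apply/imsetP; exists (u, v) => //.
  by rewrite inE.
(* An edge gives two vertices, so 2N + 1 >= 2. *)
have N_gt0 : (0 < N)%N.
  have : (1 < #|V|)%N.
    have ne : u != v by apply: contraTneq euv => ->; case: he => _ ->.
    by have := max_card (mem [set u; v]); rewrite cards2 ne.
  by move: cardN; lia.
exists (N.-1 * (#|K| - 3).+1)%N%:Z; split.
  exact: (@regularity_vanishing_ideal K V e hK N x0 (Ordinal n_gt0)).
(* Here 2N + 1 - 3 = 2(N - 1), and q - 2 = m - 1. *)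
rewrite -natrD cardN -(prednK N_gt0) -[in RHS](subnK hK) -pmulrn.
move: N.-1 (#|K| - 3)%N => N' k; rewrite -muln2.
by rewrite natrM -!natr1 natrM -natr1 natrD; field.
Qed.
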